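(* Let $g:\mathbb R\to\mathbb R$ be real-analytic with $g(0)=0$, $g'(0)=1$, and let $G(x)=\int_0^xg(s)\,ds$. Suppose there exist $a<0<b$ and $c>0$ such that $G(a)=G(b)=c$, and $G(x)<c$ and $x\,g(x)>0$ for all $a<x<b$, $x\ne0$. Let $A$ be the analytic involution of $(a,b)$ defined by $G(A(x))=G(x)$ and $A(x)\,x<0$ for $x\ne0$ (and $A(0)=0$), and regard it as a function $A=A(G)$ of $G\in[0,c)$ by setting $A(G)=A(x)$ where $x\in[0,b)$ is the point with $G(x)=G$. Then $\ddot x+g(x)=0$ admits an isochronous center at $0$ if and only if there is a function $f$, real-analytic in a neighborhood of $0$, with primitive $F(t)=\int_0^tf(s)\,ds$, such that $$2G\,\frac{dA}{dG}=A(G)+F(G)$$ for all sufficiently small $G>0$. Moreover, this solution satisfies $$A(0)=0,\qquad\lim_{G\to0}\frac{A^2}{2G}=1 .$$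
   Context: The equation $\ddot x+g(x)=0$ is identified with the planar system $\dot x=y$, $\dot y=-g(x)$. The center at the origin is called isochronous if all periodic orbits near $(0,0)$ have the same minimal period (which is then $2\pi$). *)

(* Defs.v *)
From Stdlib Require Import Reals.
From Coquelicot Require Import Coquelicot.
Open Scope R_scope.

Definition analytic_at (f : R -> R) (x0 : R) : Prop :=
  exists a : nat -> R,
    locally x0 (fun x : R => is_pseries a (x - x0) (f x)).

Definition primitive0 (f : R -> R) (x : R) : R := RInt f 0 x.

(* Global solutions of the planar system x' = y, y' = - g(x). *)
Definition is_solution (g x y : R -> R) : Prop :=
  forall t : R, is_derive x t (y t) /\ is_derive y t (- g (x t)).

Definition is_period (x y : R -> R) (T : R) : Prop :=
  0 < T /\ forall t : R, x (t + T) = x t /\ y (t + T) = y t.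

(* A constant curve has no minimal period, so having one means being a
   nontrivial periodic solution. *)
Definition is_minimal_period (x y : R -> R) (T : R) : Prop :=
  is_period x y T /\ forall S : R, is_period x y S -> T <= S.

Definition in_punctured_disc (d x y : R) : Prop :=
  0 < sqrt (x ^ 2 + y ^ 2) < d.

(* The origin is an equilibrium with a punctured neighbourhood filled with
   nontrivial periodic orbits. *)
Definition is_center (g : R -> R) : Prop :=
  g 0 = 0 /\
  exists d : R, 0 < d /\
    forall x0 y0 : R, in_punctured_disc d x0 y0 ->
      exists x y : R -> R,
        is_solution g x y /\ x 0 = x0 /\ y 0 = y0 /\
        exists T : R, is_minimal_period x y T.

(* The common period T is not prescribed. *)
Definition is_isochronous_center (g : R -> R) : Prop :=
  is_center g /\
  exists T d : R, 0 < d /\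
    forall (x y : R -> R) (S : R),
      is_solution g x y -> in_punctured_disc d (x 0) (y 0) ->
      is_minimal_period x y S -> S = T.

(* The conditions determine A on (a, b) as soon as G is strictly monotone on
   each side of 0; being an analytic involution is then a consequence and is
   not required. *)
Definition is_potential_involution (G : R -> R) (a b : R) (A : R -> R) : Prop :=
  A 0 = 0 /\
  forall x : R, a < x < b ->
    a < A x < b /\ G (A x) = G x /\ (x <> 0 -> A x * x < 0).

(* AG is A regarded as a function of the energy: AG (G x) = A x on the branch
   0 <= x < b.  The values of AG outside G([0, b)) are irrelevant. *)
Definition is_function_of_energy (G : R -> R) (b : R) (A AG : R -> R) : Prop :=
  forall x : R, 0 <= x < b -> AG (G x) = A x.

(* Main.v *)
Require Import Defs.
From Stdlib Require Import Reals Lra Lia Wf_nat Ranalysis5.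
From Coquelicot Require Import Coquelicot.
Open Scope R_scope.

(** Near [0] there is an analytic change of variable [x = phi u] with
    [G (phi u) = u ^ 2 / 2].  In the plane of [(u, y)] the orbits are circles,
    travelled with [dt = phi' u dth], so the orbit of radius [r] has period
    [int_0^(2 PI) phi' (r sin th) dth], which depends only on the even part of
    [phi'].  As a nonzero power series has a constant sign on the right of [0],
    the center is isochronous if and only if [phi'] has the even part [1].  On the
    other hand [A = phi (- sqrt (2 G))], so [2 G A' - A] is the value at
    [v = - sqrt (2 G)] of the series [v * phi' v - phi v]; it is an analytic
    function of [G] if and only if this series is even, that is, if and only if
    [phi] has no odd coefficient of order at least [3]. *)

(** * Absolutely convergent power series and interchange of summations *)

(** The obstacle is the analyticity of [phi]. Its coefficients come from a recursion on the degree,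
    and convergence from a bound on weighted sums of absolute values that reproduces itself under
    the recursion; the same bound justifies substituting one series into another. The period
    integral is never evaluated. The mean value theorem expresses the period as
    [2 * PI * (1 + E w)], with [E] the series of [period_defect] and [w] the square of one value of
    [u] on the orbit. Small orbits give arbitrarily small [w > 0], so [w] tending to 0 forces the
    common period, which is not prescribed, to be [2 * PI]; then [E] vanishes at arbitrarily small
    [w > 0], which the constant sign of a nonzero series excludes. Isochrony speaks of all
    solutions, not only of those built from the rotation. Uniqueness is therefore required, and as
    [g] is Lipschitz only near 0, conservation of energy must first confine the solutions. The two
    conditions meet in the coefficients: [v d/dv - 1] multiplies the one of degree [k] by [k - 1],
    so among odd degrees it loses only the linear term. *)

Lemma ex_series_bounded (a : nat -> R) (M : R) :
  (forall n, 0 <= a n) -> (forall N, sum_f_R0 a N <= M) ->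
  ex_series a /\ Series a <= M.
Proof.
intros Ha HM.
assert (Hex : ex_finite_lim_seq (sum_n a)).
{ apply ex_finite_lim_seq_incr with M.
  - intros n. rewrite sum_Sn. unfold plus; simpl. specialize (Ha (S n)). lra.
  - intros n. rewrite sum_n_Reals. apply HM. }
destruct Hex as [l Hl].
split; [now exists l|].
rewrite (is_series_unique a l Hl).
apply (is_lim_seq_le (sum_n a) (fun _ => M) l M); trivial.
- intros n. rewrite sum_n_Reals. apply HM.
- apply is_lim_seq_const.
Qed.

Lemma partial_sum_le_Series (a : nat -> R) (N : nat) :
  (forall n, 0 <= a n) -> ex_series a -> sum_f_R0 a N <= Series a.
Proof.
intros Ha [l Hl].
rewrite (is_series_unique a l Hl), <- sum_n_Reals.
apply (is_lim_seq_incr_compare (sum_n a) l); trivial.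
intros n. rewrite sum_Sn. unfold plus; simpl. specialize (Ha (S n)). lra.
Qed.

Lemma term_le_partial_sum (a : nat -> R) (N : nat) :
  (forall n, 0 <= a n) -> a N <= sum_f_R0 a N.
Proof.
intros Ha. destruct N as [|N]; simpl; [lra|].
assert (0 <= sum_f_R0 a N) by (apply cond_pos_sum; trivial). lra.
Qed.

Lemma ex_series_Rle (a b : nat -> R) :
  (forall n, Rabs (a n) <= b n) -> ex_series b -> ex_series a.
Proof. exact (@ex_series_le R_AbsRing R_CompleteNormedModule a b). Qed.

Lemma Series_Rabs_le (a b : nat -> R) :
  (forall n, Rabs (a n) <= b n) -> ex_series b -> Rabs (Series a) <= Series b.
Proof.
intros H Hb.
apply Rle_trans with (Series (fun n => Rabs (a n))).
- apply Series_Rabs. apply ex_series_Rle with b; trivial.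
  intros n. rewrite Rabs_Rabsolu. apply H.
- apply Series_le; trivial. intros n. split; [apply Rabs_pos | apply H].
Qed.

Lemma is_series_sum_f_R0 (b : nat -> nat -> R) (l : nat -> R) (N : nat) :
  (forall k, (k <= N)%nat -> is_series (fun n => b n k) (l k)) ->
  is_series (fun n => sum_f_R0 (b n) N) (sum_f_R0 l N).
Proof.
induction N as [|N IH]; intros H; simpl.
- apply (H 0%nat). lia.
- apply (is_series_plus (V := R_NormedModule) (fun n => sum_f_R0 (b n) N) (fun n => b n (S N))).
  + apply IH. intros k Hk. apply H. lia.
  + apply H. lia.
Qed.

(* [l1_norm rho a N] is the norm of the first terms of [a] in the Banach algebra
   of power series that converge absolutely at [rho]. *)
Definition l1_norm (rho : R) (a : nat -> R) (N : nat) : R :=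
  sum_f_R0 (fun k => Rabs (a k) * rho ^ k) N.

Lemma l1_norm_term_nonneg (rho : R) (a : nat -> R) (k : nat) :
  0 <= rho -> 0 <= Rabs (a k) * rho ^ k.
Proof. intros H. apply Rmult_le_pos; [apply Rabs_pos | now apply pow_le]. Qed.

Lemma l1_norm_nonneg (rho : R) (a : nat -> R) (N : nat) :
  0 <= rho -> 0 <= l1_norm rho a N.
Proof. intros H. apply cond_pos_sum. intros k. now apply l1_norm_term_nonneg. Qed.

Lemma CV_radius_l1_norm (rho M : R) (a : nat -> R) :
  0 <= rho -> (forall N, l1_norm rho a N <= M) -> Rbar_le rho (CV_radius a).
Proof.
intros Hr H.
apply (proj1 (CV_radius_bounded a)).
exists M. intros n.
rewrite Rabs_mult, <- RPow_abs, (Rabs_pos_eq rho Hr).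
apply Rle_trans with (2 := H n).
apply (term_le_partial_sum (fun k => Rabs (a k) * rho ^ k)).
intros k. now apply l1_norm_term_nonneg.
Qed.

Lemma l1_norm_bounded (r : R) (a : nat -> R) :
  0 <= r -> Rbar_lt r (CV_radius a) -> exists M, forall N, l1_norm r a N <= M.
Proof.
intros Hr H.
exists (Series (fun k => Rabs (a k) * r ^ k)). intros N.
apply (partial_sum_le_Series (fun k => Rabs (a k) * r ^ k)).
- intros n. now apply l1_norm_term_nonneg.
- rewrite <- (Rabs_pos_eq r Hr) in H.
  apply ex_series_ext with (2 := CV_disk_inside a r H).
  intros n. rewrite Rabs_mult, <- RPow_abs. now rewrite (Rabs_pos_eq r Hr).
Qed.

Lemma pow_ratio_le (rho u : R) (k : nat) :
  0 < rho -> Rabs u <= rho / 2 -> Rabs u ^ k <= (/ 2) ^ k * rho ^ k.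
Proof.
intros Hr Hu. rewrite <- Rpow_mult_distr.
apply pow_incr. split; [apply Rabs_pos | lra].
Qed.

(* On half the radius the tail of order [N] loses a factor [2 ^ N]; this
   uniform gain is what allows the interchange of summations below. *)
Lemma PSeries_tail_le (rho M u : R) (a : nat -> R) (N : nat) :
  0 < rho -> (forall K, l1_norm rho a K <= M) -> Rabs u <= rho / 2 ->
  Rabs (PSeries a u - sum_f_R0 (fun k => a k * u ^ k) N) <= (/ 2) ^ N * M.
Proof.
intros Hr HM Hu.
assert (Hex : ex_series (fun k => Rabs (a k) * rho ^ k)).
{ apply (ex_series_bounded _ M); trivial.
  intros n. apply l1_norm_term_nonneg. lra. }
assert (HS : Series (fun k => Rabs (a k) * rho ^ k) <= M).
{ apply (ex_series_bounded _ M); trivial.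
  intros n. apply l1_norm_term_nonneg. lra. }
assert (Hle : forall k, Rabs (a k * u ^ k) <= (/ 2) ^ k * (Rabs (a k) * rho ^ k)).
{ intros k. rewrite Rabs_mult, <- RPow_abs.
  replace ((/ 2) ^ k * (Rabs (a k) * rho ^ k)) with (Rabs (a k) * ((/ 2) ^ k * rho ^ k)) by ring.
  apply Rmult_le_compat_l; [apply Rabs_pos | now apply pow_ratio_le]. }
assert (Hhalf : forall n, 0 <= (/ 2) ^ n <= 1).
{ intros n. split; [apply pow_le; lra|]. rewrite <- (pow1 n). apply pow_incr. lra. }
assert (Hexu : ex_series (fun k => a k * u ^ k)).
{ apply ex_series_Rle with (2 := Hex). intros n.
  apply Rle_trans with (1 := Hle n).
  rewrite <- (Rmult_1_l (Rabs (a n) * rho ^ n)) at 2.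
  apply Rmult_le_compat_r; [apply l1_norm_term_nonneg; lra | apply Hhalf]. }
unfold PSeries.
rewrite (Series_incr_n (fun k => a k * u ^ k) (S N)); [|lia|exact Hexu]. simpl pred.
replace (sum_f_R0 (fun k : nat => a k * u ^ k) N +
 Series (fun k : nat => a (S N + k)%nat * u ^ (S N + k)) -
 sum_f_R0 (fun k : nat => a k * u ^ k) N) with (Series (fun k : nat => a (S N + k)%nat * u ^ (S N + k))) by ring.
apply Rle_trans with (Series (fun k => (/ 2) ^ N * (Rabs (a (S N + k)%nat) * rho ^ (S N + k)))).
- apply Series_Rabs_le.
  + intros n. apply Rle_trans with (1 := Hle (S N + n)%nat).
    apply Rmult_le_compat_r; [apply l1_norm_term_nonneg; lra|].
    (* Only the factor [(/ 2) ^ N] is kept; [(/ 2) ^ S n] is bounded by 1. *)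
    replace (S N + n)%nat with (N + S n)%nat by lia. rewrite pow_add.
    destruct (Hhalf N). destruct (Hhalf (S n)). nra.
  + apply (ex_series_scal_l ((/2)^N) (fun k => Rabs (a (S N + k)%nat) * rho ^ (S N + k))).
    now apply (ex_series_incr_n (fun k => Rabs (a k) * rho ^ k) (S N)).
- rewrite Series_scal_l. apply Rmult_le_compat_l; [apply Hhalf|].
  apply Rle_trans with (2 := HS).
  rewrite (Series_incr_n (fun k => Rabs (a k) * rho ^ k) (S N)); [|lia|exact Hex].
  assert (0 <= sum_f_R0 (fun k : nat => Rabs (a k) * rho ^ k) (pred (S N))).
  { apply cond_pos_sum. intros k. apply l1_norm_term_nonneg. lra. }
  lra.
Qed.

(** Truncated at degree [N], the interchange is a finite sum of convergent series. Adding the tail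
    bounds over [n] leaves an error of at most [(/ 2) ^ N * Series B], which tends to 0. *)
Theorem is_pseries_exchange (b : nat -> nat -> R) (B : nat -> R) (rho u : R) :
  0 < rho -> (forall n N, l1_norm rho (b n) N <= B n) -> ex_series B ->
  Rabs u <= rho / 2 ->
  ex_series (fun n => PSeries (b n) u) /\
  is_pseries (fun k => Series (fun n => b n k)) u (Series (fun n => PSeries (b n) u)).
Proof.
intros Hr HB HexB Hu.
assert (Hcoef : forall k, ex_series (fun n => b n k)).
{ intros k. apply ex_series_Rle with (fun n => B n * / rho ^ k).
  - intros n. assert (0 < rho ^ k) by now apply pow_lt.
    apply Rmult_le_reg_r with (rho ^ k); trivial.
    rewrite Rmult_assoc, Rinv_l, Rmult_1_r by lra.
    apply Rle_trans with (2 := HB n k).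
    apply (term_le_partial_sum (fun k => Rabs (b n k) * rho ^ k)).
    intros j. apply l1_norm_term_nonneg. lra.
  - now apply ex_series_scal_r. }
assert (Htail : forall n N, Rabs (PSeries (b n) u - sum_f_R0 (fun k => b n k * u ^ k) N) <= (/ 2) ^ N * B n).
{ intros n N. now apply PSeries_tail_le with rho. }
assert (Hpart : forall N, is_series (fun n => sum_f_R0 (fun k => b n k * u ^ k) N)
   (sum_f_R0 (fun k => Series (fun n => b n k) * u ^ k) N)).
{ intros N. apply (is_series_sum_f_R0 (fun n k => b n k * u ^ k)).
  intros k _. apply is_series_scal_r. now apply Series_correct. }
assert (HexBN : forall N, ex_series (fun n => (/ 2) ^ N * B n)).
{ intros N. now apply (ex_series_scal_l ((/2)^N) B). }
assert (HexP : ex_series (fun n => PSeries (b n) u)).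
{ apply ex_series_ext with (fun n => (PSeries (b n) u - sum_f_R0 (fun k => b n k * u ^ k) 0) +
     sum_f_R0 (fun k => b n k * u ^ k) 0); [intros n; simpl; ring|].
  apply (ex_series_plus (V := R_NormedModule) (fun n => PSeries (b n) u - sum_f_R0 (fun k => b n k * u ^ k) 0)).
  - apply ex_series_Rle with (fun n => (/ 2) ^ 0 * B n); [intros n; apply Htail | apply HexBN].
  - eexists. apply Hpart. }
split; trivial.
apply is_pseries_R.
set (L := Series (fun n => PSeries (b n) u)).
assert (Hd : forall N, Rabs (sum_f_R0 (fun k => Series (fun n => b n k) * u ^ k) N - L) <= (/ 2) ^ N * Series B).
{ intros N. rewrite Rabs_minus_sym. unfold L.
  rewrite <- (is_series_unique _ _ (Hpart N)).
  rewrite <- Series_minus; trivial; [|eexists; apply Hpart].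
  rewrite <- Series_scal_l. apply Series_Rabs_le; [intros n; apply Htail | apply HexBN]. }
unfold is_series.
change (is_lim_seq (sum_n (fun k => Series (fun n => b n k) * u ^ k)) L).
apply is_lim_seq_ext with (fun N => (sum_f_R0 (fun k => Series (fun n => b n k) * u ^ k) N - L) + L).
{ intros N. rewrite sum_n_Reals. ring. }
replace (Finite L) with (Rbar_plus 0 L) by (simpl; f_equal; ring).
apply is_lim_seq_plus with (l1 := 0) (l2 := L); [|apply is_lim_seq_const|reflexivity].
apply is_lim_seq_abs_0.
apply is_lim_seq_le_le with (u := fun _ => 0) (w := fun N => (/ 2) ^ N * Series B).
- intros N. split; [apply Rabs_pos | apply Hd].
- apply is_lim_seq_const.
- replace (Finite 0) with (Rbar_mult 0 (Series B)) by (simpl; f_equal; ring).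
  apply is_lim_seq_mult with (l1 := 0) (l2 := Series B); [|apply is_lim_seq_const|reflexivity].
  apply is_lim_seq_geom. rewrite Rabs_pos_eq; lra.
Qed.

Lemma PSeries_Rabs_le (a : nat -> R) (r M x : R) :
  (forall N, l1_norm r a N <= M) -> Rabs x <= r -> Rabs (PSeries a x) <= M.
Proof.
intros HM Hx. assert (h := Rabs_pos x).
assert (Hex : ex_series (fun k => Rabs (a k) * r ^ k) /\ Series (fun k => Rabs (a k) * r ^ k) <= M).
{ apply ex_series_bounded; trivial. intros n. apply l1_norm_term_nonneg. lra. }
apply Rle_trans with (2 := proj2 Hex). apply Series_Rabs_le; [|apply Hex].
intros n. rewrite Rabs_mult, <- RPow_abs. apply Rmult_le_compat_l; [apply Rabs_pos|].
apply pow_incr. split; trivial.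
Qed.

Lemma sum_f_R0_finite_support (a : nat -> R) (n N : nat) :
  (forall k, (n < k)%nat -> a k = 0) -> (n <= N)%nat -> sum_f_R0 a N = sum_f_R0 a n.
Proof.
intros H. induction 1 as [|N HN IH]; trivial.
simpl. rewrite IH, H by lia. ring.
Qed.

Lemma sum_f_R0_le_finite_support (a : nat -> R) (n N : nat) :
  (forall k, 0 <= a k) -> (forall k, (n < k)%nat -> a k = 0) ->
  sum_f_R0 a N <= sum_f_R0 a n.
Proof.
intros Ha H. destruct (Nat.le_ge_cases n N) as [h|h].
- rewrite (sum_f_R0_finite_support a n N) by trivial. lra.
- clear H. induction h as [|n h IH]; [lra|]. simpl. specialize (Ha (S n)). lra.
Qed.

Lemma Series_finite_support (a : nat -> R) (n : nat) :
  (forall k, (n < k)%nat -> a k = 0) -> Series a = sum_f_R0 a n.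
Proof.
intros H. apply is_series_unique.
unfold is_series. apply filterlim_ext_loc with (fun _ : nat => sum_f_R0 a n).
- exists n. intros N HN. rewrite sum_n_Reals. now rewrite (sum_f_R0_finite_support a n N).
- apply filterlim_const.
Qed.

(** Each monomial is expanded by the binomial formula at [x0] and the double series is summed by
    columns. At radius [r / 2] the expansion of [a n * x ^ n] has norm at most
    [Rabs (a n) * (r / 2 + Rabs x0) ^ n], hence at most [Rabs (a n) * r ^ n]. *)
Theorem PSeries_analytic_at (a : nat -> R) (r x0 : R) :
  0 < r -> Rbar_lt r (CV_radius a) -> Rabs x0 <= r / 2 -> analytic_at (PSeries a) x0.
Proof.
intros Hr Ha Hx0.
pose (b n k := if Compare_dec.le_dec k n then a n * (Binomial.C n k * x0 ^ (n - k)) else 0).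
pose (B n := Rabs (a n) * r ^ n).
assert (HC : forall n k, 0 <= Binomial.C n k).
{ intros n k. unfold Binomial.C. apply Rlt_le, Rdiv_lt_0_compat.
  - apply INR_fact_lt_0.
  - apply Rmult_lt_0_compat; apply INR_fact_lt_0. }
assert (Hb0 : forall n k, (n < k)%nat -> b n k = 0).
{ intros n k Hk. unfold b. destruct Compare_dec.le_dec; [lia|trivial]. }
assert (HB : forall n N, l1_norm (r / 2) (b n) N <= B n).
{ intros n N. unfold l1_norm, B.
  apply Rle_trans with (sum_f_R0 (fun k => Rabs (b n k) * (r / 2) ^ k) n).
  { apply sum_f_R0_le_finite_support.
    - intros k. apply l1_norm_term_nonneg. lra.
    - intros k Hk. rewrite Hb0 by trivial. rewrite Rabs_R0. ring. }
  rewrite (sum_eq _ (fun k => Binomial.C n k * (r / 2) ^ k * Rabs x0 ^ (n - k) * Rabs (a n))).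
  - rewrite <- scal_sum, <- binomial.
    apply Rmult_le_compat_l; [apply Rabs_pos|].
    apply pow_incr. assert (h := Rabs_pos x0). lra.
  - intros k Hk. unfold b. destruct Compare_dec.le_dec as [_|h]; [|lia].
    rewrite !Rabs_mult, (Rabs_pos_eq _ (HC n k)), <- RPow_abs. ring. }
assert (HexB : ex_series B).
{ rewrite <- (Rabs_pos_eq r) in Ha by lra.
  apply ex_series_ext with (2 := CV_disk_inside a r Ha).
  intros n. unfold B. rewrite Rabs_mult, <- RPow_abs. now rewrite (Rabs_pos_eq r) by lra. }
exists (fun k => Series (fun n => b n k)).
(* The rows are bounded at radius [r / 2], and the exchange is valid on half of it. *)
assert (Hr4 : 0 < r / 4) by lra.
exists (mkposreal _ Hr4). intros x Hx.
change (Rabs (x - x0) < r / 4) in Hx.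
assert (E : PSeries a x = Series (fun n => PSeries (b n) (x - x0))).
{ apply Series_ext. intros n. unfold PSeries.
  rewrite (Series_finite_support _ n).
  - replace (x ^ n) with ((x - x0 + x0) ^ n) by (f_equal; ring).
    rewrite binomial, scal_sum. apply sum_eq. intros k Hk.
    unfold b. destruct Compare_dec.le_dec as [_|h]; [|lia]. ring.
  - intros k Hk. rewrite Hb0 by trivial. ring. }
rewrite E.
apply (is_pseries_exchange b B (r / 2) (x - x0)); trivial; lra.
Qed.

(** The degrees [p + q <= N] form a triangle inside the square [p, q <= N], and the terms left out,
    isolated by [cauchy_finite], are nonnegative. *)
Lemma l1_norm_mult (rho : R) (a b : nat -> R) (N : nat) :
  0 <= rho -> l1_norm rho (PS_mult a b) N <= l1_norm rho a N * l1_norm rho b N.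
Proof.
intros Hr. unfold l1_norm.
set (An := fun k => Rabs (a k) * rho ^ k). set (Bn := fun k => Rabs (b k) * rho ^ k).
assert (HA : forall k, 0 <= An k) by (intros k; now apply l1_norm_term_nonneg).
assert (HB : forall k, 0 <= Bn k) by (intros k; now apply l1_norm_term_nonneg).
apply Rle_trans with (sum_f_R0 (fun k => sum_f_R0 (fun p => An p * Bn (k - p)%nat) k) N).
- apply sum_Rle. intros k _. unfold PS_mult.
  apply Rle_trans with (sum_f_R0 (fun p => Rabs (a p * b (k - p)%nat)) k * rho ^ k).
  + apply Rmult_le_compat_r; [now apply pow_le|]. apply Rsum_abs.
  + rewrite Rmult_comm, scal_sum. apply Req_le, sum_eq. intros p Hp.
    unfold An, Bn. rewrite Rabs_mult.
    replace (rho ^ k) with (rho ^ p * rho ^ (k - p)); [ring|].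
    rewrite <- pow_add. f_equal. lia.
- destruct N as [|N]; [simpl; lra|].
  rewrite (cauchy_finite An Bn (S N)) by lia.
  match goal with |- _ <= _ + ?s => assert (0 <= s) end; [|lra].
  apply cond_pos_sum. intros k. apply cond_pos_sum. intros l.
  now apply Rmult_le_pos.
Qed.

Fixpoint PS_pow (a : nat -> R) (m : nat) : nat -> R :=
  match m with
  | O => fun k => match k with O => 1 | S _ => 0 end
  | S m => PS_mult a (PS_pow a m)
  end.

Lemma l1_norm_one (rho : R) (a : nat -> R) (N : nat) : l1_norm rho (PS_pow a 0) N = 1.
Proof.
unfold l1_norm. rewrite (sum_f_R0_finite_support _ 0 N); simpl; [|intros [|k] Hk|lia].
- rewrite Rabs_R1. ring.
- lia.
- rewrite Rabs_R0. ring.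
Qed.

Lemma l1_norm_pow (rho : R) (a : nat -> R) (m N : nat) :
  0 <= rho -> l1_norm rho (PS_pow a m) N <= l1_norm rho a N ^ m.
Proof.
intros Hr. induction m as [|m IH].
- rewrite l1_norm_one. simpl. lra.
- apply Rle_trans with (l1_norm rho a N * l1_norm rho (PS_pow a m) N); [now apply l1_norm_mult|].
  simpl. apply Rmult_le_compat_l; trivial. now apply l1_norm_nonneg.
Qed.

Lemma l1_norm_incr_1 (rho : R) (a : nat -> R) (N : nat) :
  l1_norm rho (PS_incr_1 a) (S N) = rho * l1_norm rho a N.
Proof.
unfold l1_norm. rewrite decomp_sum by lia. simpl.
unfold zero; simpl. rewrite Rabs_R0, scal_sum.
rewrite Rmult_0_l, Rplus_0_l. apply sum_eq. intros k _. simpl. ring.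
Qed.

Lemma l1_norm_incr_n (rho : R) (a : nat -> R) (n N : nat) :
  0 <= rho -> l1_norm rho (PS_incr_n a n) N <= rho ^ n * l1_norm rho a N.
Proof.
intros Hr. revert N. induction n as [|n IH]; intros N.
{ rewrite pow_O, Rmult_1_l. apply Rle_refl. }
change (PS_incr_n a (S n)) with (PS_incr_1 (PS_incr_n a n)).
destruct N as [|N].
- unfold l1_norm at 1. simpl. unfold zero; simpl. rewrite Rabs_R0, Rmult_0_l.
  apply Rmult_le_pos; [|now apply l1_norm_nonneg].
  apply (pow_le rho (S n)); trivial.
- rewrite l1_norm_incr_1. simpl. rewrite Rmult_assoc.
  apply Rmult_le_compat_l; trivial.
  apply Rle_trans with (1 := IH N).
  apply Rmult_le_compat_l; [now apply pow_le|].
  unfold l1_norm. simpl. assert (h := l1_norm_term_nonneg rho a (S N) Hr). simpl in h. lra.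
Qed.

Lemma PSeries_PS_pow (rho M u : R) (a : nat -> R) (m : nat) :
  (forall N, l1_norm rho a N <= M) -> Rabs u < rho ->
  PSeries (PS_pow a m) u = PSeries a u ^ m.
Proof.
intros HM Hu.
assert (Hr : 0 <= rho) by (assert (h := Rabs_pos u); lra).
assert (Hlt : forall b, Rbar_le rho (CV_radius b) -> Rbar_lt (Rabs u) (CV_radius b)).
{ intros b Hb. apply Rbar_lt_le_trans with (2 := Hb). exact Hu. }
induction m as [|m IH].
- unfold PSeries. rewrite (Series_finite_support _ 0); simpl; [ring|].
  intros [|k] Hk; [lia|]. ring.
- simpl. rewrite PSeries_mult, IH; trivial.
  + apply Hlt. now apply CV_radius_l1_norm with M.
  + apply Hlt. apply CV_radius_l1_norm with (M ^ m); trivial.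
    intros N. apply Rle_trans with (1 := l1_norm_pow rho a m N Hr).
    apply pow_incr. split; [now apply l1_norm_nonneg | apply HM].
Qed.

Lemma PS_mult_ext (a a' b b' : nat -> R) (k : nat) :
  (forall j, (j <= k)%nat -> a j = a' j) -> (forall j, (j <= k)%nat -> b j = b' j) ->
  PS_mult a b k = PS_mult a' b' k.
Proof.
intros Ha Hb. apply sum_eq. intros j Hj. rewrite Ha, Hb by lia. reflexivity.
Qed.

Lemma PS_pow_ext (a a' : nat -> R) (m k : nat) :
  (forall j, (j <= k)%nat -> a j = a' j) -> PS_pow a m k = PS_pow a' m k.
Proof.
revert k. induction m as [|m IH]; intros k H; trivial.
apply PS_mult_ext; trivial. intros j Hj. apply IH. intros i Hi. apply H. lia.
Qed.

(** Under iteration from the zero sequence, coefficient [k] no longer changes after [k + 1] steps,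
    so the diagonal of the iterates is a fixed point. *)
Lemma strictly_causal_fixpoint (Psi : (nat -> R) -> nat -> R) :
  (forall z z' k, (forall j, (j < k)%nat -> z j = z' j) -> Psi z k = Psi z' k) ->
  exists z, forall k, z k = Psi z k.
Proof.
intros H.
pose (it := fix it n := match n with O => fun _ => 0 | S n => Psi (it n) end).
exists (fun k => it (S k) k).
assert (Hit : forall k n, (k < n)%nat -> it n k = it (S k) k).
{ induction k as [k IH] using Wf_nat.lt_wf_ind. intros [|n] Hn; [lia|].
  simpl. apply H. intros j Hj.
  rewrite (IH j Hj n) by lia. now rewrite (IH j Hj k) by lia. }
intros k. change (it (S k) k) with (Psi (it k) k). apply H.
intros j Hj. now rewrite (Hit j k).
Qed.

(** * The analytic chart straightening the energy *)

Lemma l1_norm_ext (rho : R) (a b : nat -> R) (N : nat) :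
  (forall k, (k <= N)%nat -> a k = b k) -> l1_norm rho a N = l1_norm rho b N.
Proof. intros H. apply sum_eq. intros k Hk. now rewrite H. Qed.

Lemma l1_norm_plus (rho : R) (a b : nat -> R) (N : nat) :
  0 <= rho ->
  l1_norm rho (fun k => a k + b k) N <= l1_norm rho a N + l1_norm rho b N.
Proof.
intros Hr. unfold l1_norm. rewrite <- sum_plus. apply sum_Rle. intros k _.
rewrite <- Rmult_plus_distr_r. apply Rmult_le_compat_r; [now apply pow_le | apply Rabs_triang].
Qed.

Lemma l1_norm_scal (rho s : R) (a : nat -> R) (N : nat) :
  l1_norm rho (fun k => s * a k) N = Rabs s * l1_norm rho a N.
Proof.
unfold l1_norm. rewrite scal_sum. apply sum_eq. intros k _. rewrite Rabs_mult. ring.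
Qed.

Lemma l1_norm_sum (rho : R) (b : nat -> nat -> R) (m N : nat) :
  0 <= rho ->
  l1_norm rho (fun k => sum_f_R0 (fun n => b n k) m) N <=
  sum_f_R0 (fun n => l1_norm rho (b n) N) m.
Proof.
intros Hr. induction m as [|m IH]; simpl; [apply Rle_refl|].
apply Rle_trans with (1 := l1_norm_plus rho (fun k => sum_f_R0 (fun n => b n k) m) (b (S m)) N Hr).
lra.
Qed.

(* With [x = u v] and [v = 1 + u z] the equation [x ^ 2 (1 + x c(x)) = u ^ 2]
   becomes [z = - (u z ^ 2 + sum_n c_n u ^ n v ^ (n + 3)) / 2], whose right-hand
   side involves in degree [k] only coefficients of [z] of degree below [k]. *)
Definition one_plus_incr (z : nat -> R) (k : nat) : R :=
  match k with O => 1 | S j => z j end.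

Definition normal_form_term (c z : nat -> R) (n k : nat) : R :=
  c n * PS_incr_n (PS_pow (one_plus_incr z) (n + 3)) n k.

Definition normal_form_map (c z : nat -> R) (k : nat) : R :=
  - / 2 * (PS_incr_1 (PS_mult z z) k + sum_f_R0 (fun n => normal_form_term c z n k) k).

Lemma normal_form_term_0 (c z : nat -> R) (n k : nat) :
  (k < n)%nat -> normal_form_term c z n k = 0.
Proof.
intros H. unfold normal_form_term. rewrite PS_incr_n_simplify.
destruct Compare_dec.le_lt_dec; [lia|]. apply Rmult_0_r.
Qed.

Lemma normal_form_map_causal (c z z' : nat -> R) (k : nat) :
  (forall j, (j < k)%nat -> z j = z' j) -> normal_form_map c z k = normal_form_map c z' k.
Proof.
intros H. unfold normal_form_map. f_equal. f_equal.
- destruct k as [|k]; trivial. simpl. apply PS_mult_ext; intros j Hj; apply H; lia.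
- apply sum_eq. intros n Hn. unfold normal_form_term. f_equal.
  rewrite !PS_incr_n_simplify. destruct Compare_dec.le_lt_dec; trivial.
  apply PS_pow_ext. intros [|j] Hj; trivial. simpl. apply H. lia.
Qed.

Lemma l1_norm_normal_form_term (c z : nat -> R) (rho D : R) (n N : nat) :
  0 <= rho -> l1_norm rho (one_plus_incr z) N <= D ->
  l1_norm rho (normal_form_term c z n) N <= Rabs (c n) * (D * rho) ^ n * D ^ 3.
Proof.
intros Hr HD.
assert (H0 := l1_norm_nonneg rho (one_plus_incr z) N Hr).
unfold normal_form_term. rewrite l1_norm_scal.
rewrite !Rmult_assoc. apply Rmult_le_compat_l; [apply Rabs_pos|].
apply Rle_trans with (rho ^ n * D ^ (n + 3)).
- apply Rle_trans with (1 := l1_norm_incr_n _ _ _ _ Hr).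
  apply Rmult_le_compat_l; [now apply pow_le|].
  apply Rle_trans with (1 := l1_norm_pow _ _ _ _ Hr).
  apply pow_incr. split; trivial.
- apply Req_le. rewrite pow_add, Rpow_mult_distr. ring.
Qed.

Lemma l1_norm_one_plus_incr (rho M : R) (z : nat -> R) (N : nat) :
  0 <= rho -> 0 <= M -> (forall j, (j < N)%nat -> l1_norm rho z j <= M) ->
  l1_norm rho (one_plus_incr z) N <= 1 + rho * M.
Proof.
intros Hr HM H. destruct N as [|N].
- unfold l1_norm. simpl. rewrite Rabs_R1. assert (0 <= rho * M) by now apply Rmult_le_pos. lra.
- unfold l1_norm. rewrite decomp_sum by lia. simpl. rewrite Rabs_R1, Rmult_1_r.
  apply Rplus_le_compat_l.
  apply Rle_trans with (rho * l1_norm rho z N).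
  + unfold l1_norm. rewrite scal_sum. apply Req_le, sum_eq. intros k _. ring.
  + apply Rmult_le_compat_l; trivial. apply H. lia.
Qed.

(** Strong induction on the truncation degree, the right-hand side using only lower ones. As
    [rho * M <= 1], the norm of [v] is at most 2, whence the factor [8 = 2 ^ 3] and the condition
    [2 * rho <= r]. The bound reproduces itself because half of [rho * M ^ 2 + 8 * C0] is at most
    half of [M + 8 * C0], hence at most [M]. *)
Lemma l1_norm_normal_form_solution (c z : nat -> R) (r rho C0 M : R) :
  (forall k, z k = normal_form_map c z k) ->
  (forall N, l1_norm r c N <= C0) -> 0 < rho -> 2 * rho <= r ->
  M = 8 * C0 + 1 -> rho * M <= 1 ->
  forall N, l1_norm rho z N <= M.
Proof.
intros Hz HC Hr Hrr HM HrM.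
assert (HC0 : 0 <= C0).
{ apply Rle_trans with (2 := HC 0%nat). apply l1_norm_nonneg. lra. }
induction N as [N IH] using lt_wf_ind.
(* The terms with [n > k] vanish, so the inner sum may run up to the fixed bound [N], as the
   triangle inequality for finite sums of series requires. *)
rewrite (l1_norm_ext rho z (fun k => - / 2 * (PS_incr_1 (PS_mult z z) k +
   sum_f_R0 (fun n => normal_form_term c z n k) N))).
2:{ intros k Hk. rewrite Hz at 1. unfold normal_form_map. f_equal. f_equal.
    symmetry. apply sum_f_R0_finite_support; trivial. intros n Hn. now apply normal_form_term_0. }
rewrite l1_norm_scal, Rabs_left by lra.
assert (Hv : l1_norm rho (one_plus_incr z) N <= 2).
{ apply Rle_trans with (1 + rho * M); [|lra]. apply l1_norm_one_plus_incr; trivial; lra. }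
assert (H1 : l1_norm rho (PS_incr_1 (PS_mult z z)) N <= M).
{ destruct N as [|N].
  - unfold l1_norm; simpl. unfold zero; simpl. rewrite Rabs_R0. lra.
  - rewrite l1_norm_incr_1.
    assert (h : l1_norm rho z N <= M) by (apply IH; lia).
    assert (h0 : 0 <= l1_norm rho z N) by (apply l1_norm_nonneg; lra).
    assert (h2 := l1_norm_mult rho z z N (Rlt_le _ _ Hr)).
    apply Rle_trans with (rho * (M * M)); [|nra].
    apply Rmult_le_compat_l; [lra|]. apply Rle_trans with (1 := h2).
    now apply Rmult_le_compat. }
assert (H2 : l1_norm rho (fun k => sum_f_R0 (fun n => normal_form_term c z n k) N) N <= 8 * C0).
{ apply Rle_trans with (1 := l1_norm_sum rho (normal_form_term c z) N N (Rlt_le _ _ Hr)).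
  apply Rle_trans with (8 * l1_norm r c N); [|specialize (HC N); lra].
  unfold l1_norm at 2. rewrite scal_sum. apply sum_Rle. intros n _.
  apply Rle_trans with (1 := l1_norm_normal_form_term c z rho 2 n N (Rlt_le _ _ Hr) Hv).
  replace (2 ^ 3) with 8 by ring. apply Rmult_le_compat_r; [lra|].
  apply Rmult_le_compat_l; [apply Rabs_pos|]. apply pow_incr. lra. }
assert (h := l1_norm_plus rho (PS_incr_1 (PS_mult z z))
  (fun k => sum_f_R0 (fun n => normal_form_term c z n k) N) N (Rlt_le _ _ Hr)).
simpl in h |- *. lra.
Qed.

(** Turns the equation between coefficients into one between functions. Summed over [n] first, the
    terms form the composite of [c] with [u * v]; the exchange is majorized by
    [Rabs (c n) * (2 * rho) ^ n * 2 ^ 3], where 2 bounds the norm of [v]. *)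
Lemma PSeries_normal_form_solution (c z : nat -> R) (r rho C0 M u : R) :
  (forall k, z k = normal_form_map c z k) ->
  (forall N, l1_norm r c N <= C0) -> 0 < rho -> 2 * rho <= r ->
  M = 8 * C0 + 1 -> rho * M <= 1 -> Rabs u <= rho / 2 ->
  PSeries z u = - / 2 * (u * PSeries z u ^ 2 +
     (1 + u * PSeries z u) ^ 3 * PSeries c (u * (1 + u * PSeries z u))).
Proof.
intros Hz HC Hr Hrr HM HrM Hu.
assert (HzM := l1_norm_normal_form_solution c z r rho C0 M Hz HC Hr Hrr HM HrM).
assert (HC0 : 0 <= C0).
{ apply Rle_trans with (2 := HC 0%nat). apply l1_norm_nonneg. lra. }
assert (Hv : forall N, l1_norm rho (one_plus_incr z) N <= 2).
{ intros N. apply Rle_trans with (1 + rho * M); [|lra].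
  apply l1_norm_one_plus_incr; [lra|lra|]. intros j _. apply HzM. }
assert (Hru : Rabs u < rho) by lra.
assert (Hlt : forall b K, (forall N, l1_norm rho b N <= K) -> Rbar_lt (Rabs u) (CV_radius b)).
{ intros b K Hb. apply Rbar_lt_le_trans with rho; [exact Hru|].
  apply CV_radius_l1_norm with K; trivial. lra. }
set (q := fun k => Series (fun n => normal_form_term c z n k)).
assert (Hq : forall k, q k = sum_f_R0 (fun n => normal_form_term c z n k) k).
{ intros k. apply Series_finite_support. intros n Hn. now apply normal_form_term_0. }
destruct (is_pseries_exchange (normal_form_term c z)
  (fun n => Rabs (c n) * (2 * rho) ^ n * 2 ^ 3) rho u) as [_ Hpq]; trivial.
{ intros n N. apply l1_norm_normal_form_term; [lra | apply Hv]. }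
{ apply ex_series_scal_r. apply (ex_series_bounded _ C0).
  - intros n. apply l1_norm_term_nonneg. lra.
  - intros N. apply Rle_trans with (2 := HC N). apply sum_Rle. intros n _.
    apply Rmult_le_compat_l; [apply Rabs_pos|]. apply pow_incr. lra. }
fold q in Hpq.
assert (Ev : PSeries (one_plus_incr z) u = 1 + u * PSeries z u).
{ rewrite PSeries_decr_1.
  - reflexivity.
  - apply CV_radius_inside. apply (Hlt _ 2), Hv. }
assert (Eterm : forall n, PSeries (normal_form_term c z n) u =
   (c n * (u * (1 + u * PSeries z u)) ^ n) * (1 + u * PSeries z u) ^ 3).
{ intros n. change (normal_form_term c z n) with
   (PS_scal (c n) (PS_incr_n (PS_pow (one_plus_incr z) (n + 3)) n)).
  rewrite PSeries_scal, PSeries_incr_n.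
  rewrite (PSeries_PS_pow rho 2) by trivial. rewrite Ev, Rpow_mult_distr, pow_add. ring. }
rewrite (Series_ext _ _ Eterm), Series_scal_r in Hpq.
change (Series (fun n => c n * (u * (1 + u * PSeries z u)) ^ n)) with
  (PSeries c (u * (1 + u * PSeries z u))) in Hpq.
assert (Hexq := ex_intro (fun l => is_pseries q u l) _ Hpq).
apply is_pseries_unique in Hpq.
assert (Hexz : Rbar_lt (Rabs u) (CV_radius z)) by now apply (Hlt _ M).
assert (Hexm : ex_pseries (PS_incr_1 (PS_mult z z)) u).
{ apply ex_pseries_incr_1. apply ex_pseries_mult; trivial. }
rewrite (PSeries_ext z (PS_scal (- / 2) (PS_plus (PS_incr_1 (PS_mult z z)) q))) at 1.
2:{ intros k. rewrite Hz. unfold normal_form_map. rewrite <- Hq. reflexivity. }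
rewrite PSeries_scal, PSeries_plus, PSeries_incr_1, PSeries_mult by trivial.
rewrite Hpq. ring.
Qed.

Theorem PSeries_square_normal_form (c : nat -> R) (r : R) :
  0 < r -> Rbar_lt r (CV_radius c) ->
  exists (p : nat -> R) (rho : R),
    0 < rho /\ p 0%nat = 0 /\ p 1%nat = 1 /\ Rbar_lt rho (CV_radius p) /\
    forall u, Rabs u <= rho ->
      Rabs (PSeries p u) < r /\
      PSeries p u ^ 2 * (1 + PSeries p u * PSeries c (PSeries p u)) = u ^ 2.
Proof.
intros Hr Hc.
destruct (l1_norm_bounded r c (Rlt_le _ _ Hr) Hc) as [C0 HC].
destruct (strictly_causal_fixpoint (normal_form_map c)) as [z Hz].
{ intros z z' k. apply normal_form_map_causal. }
assert (HC0 : 0 <= C0).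
{ apply Rle_trans with (2 := HC 0%nat). apply l1_norm_nonneg. lra. }
set (M := 8 * C0 + 1).
assert (HM : 0 < / M) by (apply Rinv_0_lt_compat; unfold M; lra).
set (rho := Rmin (r / 2) (/ M)).
assert (Hrho : 0 < rho) by (apply Rmin_pos; lra).
assert (Hrr : 2 * rho <= r) by (assert (h := Rmin_l (r / 2) (/ M)); fold rho in h; lra).
assert (HrM : rho * M <= 1).
{ rewrite <- (Rinv_l M) by (unfold M; lra).
  apply Rmult_le_compat_r; [unfold M; lra | apply Rmin_r]. }
assert (HzM := l1_norm_normal_form_solution c z r rho C0 M Hz HC Hrho Hrr eq_refl HrM).
assert (Hv : forall N, l1_norm rho (one_plus_incr z) N <= 2).
{ intros N. apply Rle_trans with (1 + rho * M); [|lra].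
  apply l1_norm_one_plus_incr; [lra|unfold M; lra|]. intros j _. apply HzM. }
assert (Hvr : Rbar_lt (rho / 2) (CV_radius (one_plus_incr z))).
{ apply Rbar_lt_le_trans with rho; [simpl; lra|].
  apply CV_radius_l1_norm with 2; trivial. lra. }
assert (Hzr : Rbar_le rho (CV_radius z)).
{ apply CV_radius_l1_norm with M; trivial. lra. }
exists (PS_incr_1 (one_plus_incr z)), (rho / 2).
split; [lra|]. split; [reflexivity|]. split; [reflexivity|].
split; [now rewrite CV_radius_incr_1|].
intros u Hu.
assert (Hex : ex_pseries (one_plus_incr z) u).
{ apply CV_radius_inside. apply Rbar_le_lt_trans with (2 := Hvr). exact Hu. }
assert (Ev : PSeries (one_plus_incr z) u = 1 + u * PSeries z u).
{ rewrite PSeries_decr_1 by trivial. reflexivity. }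
rewrite PSeries_incr_1, Ev.
assert (E := PSeries_normal_form_solution c z r rho C0 M u Hz HC Hrho Hrr eq_refl HrM Hu).
set (Z := PSeries z u) in *.
assert (HZ : Rabs Z <= M).
{ apply PSeries_Rabs_le with rho; trivial. lra. }
split.
- rewrite Rabs_mult.
  assert (Rabs (1 + u * Z) < 2).
  { apply Rle_lt_trans with (1 := Rabs_triang _ _). rewrite Rabs_R1, Rabs_mult.
    assert (Rabs u * Rabs Z <= rho / 2 * M); [|lra].
    apply Rmult_le_compat; trivial; apply Rabs_pos. }
  assert (0 <= Rabs u) by apply Rabs_pos. assert (0 <= Rabs (1 + u * Z)) by apply Rabs_pos. nra.
- set (K := PSeries c (u * (1 + u * Z))) in *.
  (* After expansion, substituting this value of [2 * Z] reduces the cofactor of [u ^ 2] to 1. *)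
  assert (E2 : 2 * Z = - (u * Z ^ 2 + (1 + u * Z) ^ 3 * K)) by lra.
  replace ((u * (1 + u * Z)) ^ 2 * (1 + u * (1 + u * Z) * K)) with
    (u ^ 2 * (1 + u * (2 * Z) + u ^ 2 * Z ^ 2 + u * ((1 + u * Z) ^ 3 * K))) by ring.
  rewrite E2. ring.
Qed.

(** * Local expansions of analytic functions and of the potential *)

Lemma CV_radius_ge_of_ex_pseries (a : nat -> R) (y : R) :
  ex_pseries a y -> Rbar_le (Rabs y) (CV_radius a).
Proof.
intros H. apply Rbar_not_lt_le. intros h.
apply (CV_disk_outside a y h). apply ex_series_lim_0. now apply ex_pseries_R.
Qed.

Lemma analytic_at_PSeries (f : R -> R) (x0 : R) :
  analytic_at f x0 -> exists (a : nat -> R) (r : R),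
    0 < r /\ Rbar_lt r (CV_radius a) /\
    forall x, Rabs (x - x0) <= r -> f x = PSeries a (x - x0).
Proof.
(* Convergence at [e / 2] makes the radius of convergence strictly larger than [e / 3]. *)
intros [a [e He]]. exists a, (e / 3).
assert (H0 := cond_pos e).
split; [lra|]. split.
- apply Rbar_lt_le_trans with (Rabs (e / 2)); [simpl; rewrite Rabs_pos_eq; lra|].
  apply CV_radius_ge_of_ex_pseries. exists (f (x0 + e / 2)).
  assert (h : ball x0 e (x0 + e / 2)).
  { change (Rabs (x0 + e / 2 - x0) < e).
    replace (x0 + e / 2 - x0) with (e / 2) by ring. rewrite Rabs_pos_eq; lra. }
  apply He in h. now replace (x0 + e / 2 - x0) with (e / 2) in h by ring.
- intros x Hx. symmetry. apply is_pseries_unique. apply He.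
  change (Rabs (x - x0) < e). lra.
Qed.

Lemma Rbar_lt_CV_radius (a : nat -> R) (r u : R) :
  Rbar_lt r (CV_radius a) -> Rabs u <= r -> Rbar_lt (Rabs u) (CV_radius a).
Proof. intros H Hu. now apply Rbar_le_lt_trans with r. Qed.

Lemma continuous_PSeries (a : nat -> R) (r u : R) :
  Rbar_lt r (CV_radius a) -> Rabs u <= r -> continuous (PSeries a) u.
Proof.
intros H Hu. apply (ex_derive_continuous (PSeries a) u). apply ex_derive_PSeries.
now apply Rbar_lt_CV_radius with r.
Qed.

Lemma locally_Rabs (x0 r : R) (P : R -> Prop) :
  0 < r -> (forall x, Rabs (x - x0) < r -> P x) -> locally x0 P.
Proof. intros Hr H. exists (mkposreal r Hr). intros x Hx. apply H, Hx. Qed.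

Lemma analytic_at_continuous (f : R -> R) (x0 : R) : analytic_at f x0 -> continuous f x0.
Proof.
intros H. destruct (analytic_at_PSeries f x0 H) as (a & r & Hr & Hc & E).
apply (continuous_ext_loc f (fun x => PSeries a (x - x0)) x0).
- apply locally_Rabs with r; trivial. intros x Hx. symmetry. apply E. lra.
- apply (continuous_comp (fun x => x - x0) (PSeries a)).
  + apply (continuous_minus (fun x : R => x) (fun _ => x0)); [apply continuous_id|apply continuous_const].
  + apply continuous_PSeries with r; trivial. rewrite Rminus_diag, Rabs_R0. lra.
Qed.

Lemma is_derive_primitive0 (g : R -> R) :
  (forall x, continuous g x) -> forall x, is_derive (primitive0 g) x (g x).
Proof.
intros Hg x. apply (is_derive_RInt g (primitive0 g) 0 x); [|apply Hg].
apply filter_forall. intros y. apply (RInt_correct g).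
apply (ex_RInt_continuous (V := R_CompleteNormedModule)). intros z _. apply Hg.
Qed.

Lemma primitive0_PSeries (f : R -> R) (a : nat -> R) (r : R) :
  Rbar_lt r (CV_radius a) -> (forall x, Rabs x <= r -> f x = PSeries a x) ->
  forall x, Rabs x <= r -> primitive0 f x = PSeries (PS_Int a) x.
Proof.
intros Ha E x Hx. unfold primitive0.
rewrite (RInt_ext f (PSeries a)).
- apply RInt_PSeries. now apply Rbar_lt_CV_radius with r.
- intros y Hy. apply E. revert Hy Hx. unfold Rmin, Rmax, Rabs.
  destruct Rle_dec, Rcase_abs, Rcase_abs; lra.
Qed.

Lemma potential_normal_form (g : R -> R) :
  analytic_at g 0 -> g 0 = 0 -> is_derive g 0 1 ->
  exists (c : nat -> R) (r : R), 0 < r /\ Rbar_lt r (CV_radius c) /\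
    forall x, Rabs x <= r -> primitive0 g x = x ^ 2 / 2 * (1 + x * PSeries c x).
Proof.
intros Hg g0 g1.
destruct (analytic_at_PSeries g 0 Hg) as (a & r & Hr & Hc & E).
assert (E' : forall x, Rabs x <= r -> g x = PSeries a x).
{ intros x Hx. rewrite E; rewrite Rminus_0_r; trivial. }
assert (H0 : Rabs 0 <= r) by (rewrite Rabs_R0; lra).
assert (a0 : a 0%nat = 0).
{ rewrite <- PSeries_0, <- E'; trivial. }
assert (a1 : a 1%nat = 1).
{ replace (a 1%nat) with (PS_derive a 0) by (unfold PS_derive; simpl; ring).
  rewrite <- PSeries_0.
  rewrite <- (is_derive_unique (PSeries a) 0 (PSeries (PS_derive a) 0)).
  - apply is_derive_unique. apply is_derive_ext_loc with (2 := g1).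
    apply locally_Rabs with r; trivial. intros x Hx. apply E'. rewrite Rminus_0_r in Hx. lra.
  - apply is_derive_PSeries. now apply Rbar_lt_CV_radius with r. }
pose (b := PS_Int a).
assert (Hb : CV_radius b = CV_radius a) by apply CV_radius_Int.
(* The potential starts with [x ^ 2 / 2]. What remains is [x ^ 3] times the series shifted three
   times, and the factor 2 compensates for [x ^ 2 / 2] being put in front. *)
exists (PS_scal 2 (PS_decr_1 (PS_decr_1 (PS_decr_1 b)))), r.
split; trivial. split.
{ rewrite CV_radius_scal by lra. now rewrite !CV_radius_decr_1, Hb. }
intros x Hx. rewrite (primitive0_PSeries g a r) by trivial. fold b.
assert (Hxb : Rbar_lt (Rabs x) (CV_radius b)) by (rewrite Hb; now apply Rbar_lt_CV_radius with r).
rewrite (PSeries_decr_1 b x) by now apply CV_radius_inside.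
rewrite (PSeries_decr_1 (PS_decr_1 b) x) by (apply CV_radius_inside; now rewrite CV_radius_decr_1).
rewrite (PSeries_decr_1 (PS_decr_1 (PS_decr_1 b)) x)
  by (apply CV_radius_inside; now rewrite !CV_radius_decr_1).
rewrite PSeries_scal.
unfold PS_decr_1 at 1 2 3, b at 1 2 3, PS_Int at 1 2 3. rewrite a0, a1. simpl INR. field.
Qed.

(* [phi u] is the point on the side of the sign of [u] with energy [u ^ 2 / 2],
   so that the energy levels are circles in the plane of [(u, y)]. *)
Theorem energy_parametrization (g : R -> R) :
  analytic_at g 0 -> g 0 = 0 -> is_derive g 0 1 ->
  exists (p : nat -> R) (rho : R),
    0 < rho /\ p 0%nat = 0 /\ p 1%nat = 1 /\ Rbar_lt rho (CV_radius p) /\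
    forall u, Rabs u <= rho -> primitive0 g (PSeries p u) = u ^ 2 / 2.
Proof.
intros Hg g0 g1.
destruct (potential_normal_form g Hg g0 g1) as (c & r & Hr & Hc & E).
destruct (PSeries_square_normal_form c r Hr Hc) as (p & rho & Hrho & p0 & p1 & Hp & Ep).
exists p, rho. repeat split; trivial.
intros u Hu. destruct (Ep u Hu) as [h1 h2].
rewrite E by lra. rewrite <- h2. field.
Qed.

(** * Inversion of increasing functions on the line *)

Lemma bounded_derive_incr (F f : R -> R) (m a b : R) :
  (forall x, a <= x <= b -> is_derive F x (f x)) -> (forall x, a <= x <= b -> m <= f x) ->
  a <= b -> m * (b - a) <= F b - F a.
Proof.
intros HF Hf Hab.
destruct (MVT_gen F a b f) as (c & Hc & E).
- intros x Hx. rewrite Rmin_left, Rmax_right in Hx by lra. apply HF. lra.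
- intros x Hx. rewrite Rmin_left, Rmax_right in Hx by lra.
  apply continuity_pt_filterlim. apply (ex_derive_continuous F). exists (f x). now apply HF.
- rewrite Rmin_left, Rmax_right in Hc by lra.
  rewrite E. apply Rmult_le_compat_r; [lra|now apply Hf].
Qed.

(** Growth at rate at least [m] makes [F] a bijection of the line with an inverse of Lipschitz
    constant [/ m]. It is used to express the angle as a function of time for all times, since
    [is_solution] asks for global curves. *)
Lemma global_inverse (F f : R -> R) (m : R) :
  0 < m -> (forall x, is_derive F x (f x)) -> (forall x, m <= f x) ->
  exists Th : R -> R, (forall t, F (Th t) = t) /\ (forall x, Th (F x) = x) /\
    forall t, is_derive Th t (/ f (Th t)).
Proof.
intros Hm HF Hf.
assert (Hincr : forall a b, a <= b -> m * (b - a) <= F b - F a).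
{ intros a b. apply bounded_derive_incr with f; intros; auto. }
assert (Hinj : forall a b, F a = F b -> a = b).
{ intros a b E. destruct (Rle_or_lt a b) as [h|h].
  - specialize (Hincr a b h). nra.
  - specialize (Hincr b a (Rlt_le _ _ h)). nra. }
assert (HIVT : forall t, {x | F x = t}).
{ intros t. set (K := Rabs (t - F 0) / m).
  assert (HK : 0 <= K) by (apply Rdiv_le_0_compat; [apply Rabs_pos|trivial]).
  assert (EK : m * K = Rabs (t - F 0)) by (unfold K; field; lra).
  destruct (IVT_gen F (- K) K t) as [x [_ Hx]].
  - intros x. apply continuity_pt_filterlim. apply (ex_derive_continuous F). now exists (f x).
  - assert (h1 := Hincr (- K) 0 ltac:(lra)). assert (h2 := Hincr 0 K ltac:(lra)).
    assert (h3 := Rle_abs (t - F 0)). assert (h4 := Rle_abs (- (t - F 0))).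
    rewrite Rabs_Ropp in h4.
    split; [apply Rle_trans with (1 := Rmin_l _ _) | apply Rle_trans with (2 := Rmax_r _ _)]; lra.
  - now exists x. }
pose (Th t := proj1_sig (HIVT t)).
assert (HTh : forall t, F (Th t) = t) by (intros t; apply (proj2_sig (HIVT t))).
exists Th. split; trivial. split; [intros x; apply Hinj, HTh|].
assert (Hlip : forall t s, m * Rabs (Th s - Th t) <= Rabs (s - t)).
{ intros t s. destruct (Rle_or_lt (Th t) (Th s)) as [h|h].
  - specialize (Hincr _ _ h). rewrite !HTh in Hincr. rewrite (Rabs_pos_eq (Th s - Th t)) by lra.
    apply Rle_trans with (1 := Hincr). apply Rle_abs.
  - specialize (Hincr _ _ (Rlt_le _ _ h)). rewrite !HTh in Hincr.
    rewrite (Rabs_left (Th s - Th t)) by lra. rewrite <- Rabs_Ropp.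
    apply Rle_trans with (- (s - t)); [lra|]. apply Rle_abs. }
intros t. apply is_derive_Reals. intros eps Heps.
assert (Hd := proj1 (is_derive_Reals _ _ _) (HF (Th t))).
(* The difference of the inverses of [h / k] and [f (Th t)] is the difference of these two numbers
   divided by their product, which is at least [m * m]. *)
assert (Heps' : 0 < eps * (m * m)) by (repeat apply Rmult_lt_0_compat; trivial).
destruct (Hd _ Heps') as [d Hdd].
assert (Hd0 := cond_pos d).
assert (Hmd : 0 < m * d) by (apply Rmult_lt_0_compat; trivial).
exists (mkposreal _ Hmd). intros h Hh0 Hh. simpl in Hh.
set (k := Th (t + h) - Th t).
assert (Ek : F (Th t + k) - F (Th t) = h).
{ unfold k. replace (Th t + (Th (t + h) - Th t)) with (Th (t + h)) by ring. rewrite !HTh. ring. }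
assert (Hk0 : k <> 0).
{ intros E. rewrite E, Rplus_0_r in Ek. lra. }
assert (Hk : Rabs k < d).
{ specialize (Hlip t (t + h)). fold k in Hlip. replace (t + h - t) with h in Hlip by ring. nra. }
specialize (Hdd k Hk0 Hk). rewrite Ek in Hdd.
assert (Hq : m <= h / k).
{ destruct (Rle_or_lt 0 k) as [hk|hk].
  - assert (hh := Hincr (Th t) (Th t + k) ltac:(lra)). rewrite Ek in hh.
    apply Rmult_le_reg_r with k; [lra|]. unfold Rdiv. rewrite Rmult_assoc, Rinv_l by trivial. lra.
  - assert (hh := Hincr (Th t + k) (Th t) ltac:(lra)).
    replace (F (Th t) - F (Th t + k)) with (- h) in hh by lra.
    apply Rmult_le_reg_r with (- k); [lra|]. unfold Rdiv.
    replace (h * / k * - k) with (- (h * (/ k * k))) by ring. rewrite Rinv_l by trivial. lra. }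
specialize (Hf (Th t)).
replace (k / h - / f (Th t)) with ((f (Th t) - h / k) * (/ (h / k) * / f (Th t)))
  by (field; repeat split; lra).
rewrite Rabs_mult, (Rabs_minus_sym (f (Th t))).
assert (Hi : forall w, m <= w -> 0 < / w <= / m).
{ intros w Hw. split; [apply Rinv_0_lt_compat; lra|apply Rinv_le_contravar; trivial]. }
assert (h1 := Hi _ Hq). assert (h2 := Hi _ Hf).
rewrite (Rabs_pos_eq (/ (h / k) * / f (Th t))) by (apply Rmult_le_pos; lra).
apply Rle_lt_trans with (Rabs (h / k - f (Th t)) * (/ m * / m)).
- apply Rmult_le_compat_l; [apply Rabs_pos|]. apply Rmult_le_compat; lra.
- apply Rmult_lt_reg_r with (m * m); [now apply Rmult_lt_0_compat|].
  replace (Rabs (h / k - f (Th t)) * (/ m * / m) * (m * m)) with (Rabs (h / k - f (Th t))) by (field; lra).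
  exact Hdd.
Qed.

(** * The flow as a rotation with a time change *)

Lemma is_derive_comp_R (f h : R -> R) (x df dh : R) :
  is_derive f (h x) df -> is_derive h x dh -> is_derive (fun t => f (h t)) x (df * dh).
Proof.
intros Hf Hh. rewrite Rmult_comm. exact (is_derive_comp f h x df dh Hf Hh).
Qed.

Lemma is_derive_0_const (F : R -> R) :
  (forall x, is_derive F x 0) -> forall a b, F a = F b.
Proof.
intros HF a b. destruct (MVT_gen F a b (fun _ => 0)) as (c & _ & E).
- intros x _. apply HF.
- intros x _. apply continuity_pt_filterlim. apply (ex_derive_continuous F). now exists 0.
- lra.
Qed.

(** With [rot_y], the flow of the harmonic oscillator [u' = y], [y' = - u] from [(u0, y0)]. *)
Definition rot_x (u0 y0 th : R) : R := u0 * cos th + y0 * sin th.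
Definition rot_y (u0 y0 th : R) : R := y0 * cos th - u0 * sin th.

Lemma is_derive_rot_x (u0 y0 th : R) : is_derive (rot_x u0 y0) th (rot_y u0 y0 th).
Proof. unfold rot_x, rot_y. auto_derive; trivial. ring. Qed.

Lemma is_derive_rot_y (u0 y0 th : R) : is_derive (rot_y u0 y0) th (- rot_x u0 y0 th).
Proof. unfold rot_x, rot_y. auto_derive; trivial. ring. Qed.

Lemma rot_norm (u0 y0 th : R) : rot_x u0 y0 th ^ 2 + rot_y u0 y0 th ^ 2 = u0 ^ 2 + y0 ^ 2.
Proof.
unfold rot_x, rot_y.
replace (_ + _) with ((u0 ^ 2 + y0 ^ 2) * (Rsqr (sin th) + Rsqr (cos th))) by (unfold Rsqr; ring).
rewrite sin2_cos2. ring.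
Qed.

Lemma rot_x_lt (u0 y0 rho th : R) :
  0 < rho -> u0 ^ 2 + y0 ^ 2 < rho ^ 2 -> Rabs (rot_x u0 y0 th) < rho.
Proof.
intros Hr H. rewrite <- (rot_norm u0 y0 th) in H.
rewrite <- (Rabs_pos_eq rho) by lra. apply Rsqr_lt_abs_0. unfold Rsqr. nra.
Qed.

Lemma rot_x_0 (u0 y0 : R) : rot_x u0 y0 0 = u0.
Proof. unfold rot_x. rewrite cos_0, sin_0. ring. Qed.

Lemma rot_y_0 (u0 y0 : R) : rot_y u0 y0 0 = y0.
Proof. unfold rot_y. rewrite cos_0, sin_0. ring. Qed.

Lemma rot_x_PI (u0 y0 th : R) : rot_x u0 y0 (th + PI) = - rot_x u0 y0 th.
Proof. unfold rot_x. rewrite neg_cos, neg_sin. ring. Qed.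

Lemma rot_y_PI (u0 y0 th : R) : rot_y u0 y0 (th + PI) = - rot_y u0 y0 th.
Proof. unfold rot_y. rewrite neg_cos, neg_sin. ring. Qed.

Lemma rot_x_2PI (u0 y0 th : R) : rot_x u0 y0 (th + 2 * PI) = rot_x u0 y0 th.
Proof. replace (th + 2 * PI) with (th + PI + PI) by ring. rewrite !rot_x_PI. ring. Qed.

Lemma rot_y_2PI (u0 y0 th : R) : rot_y u0 y0 (th + 2 * PI) = rot_y u0 y0 th.
Proof. replace (th + 2 * PI) with (th + PI + PI) by ring. rewrite !rot_y_PI. ring. Qed.

(** The scalar product with [(u0, y0)] gives [cos th = 1], that is [sin (th / 2) = 0], which is
    impossible when [0 < th < 2 * PI]. *)
Lemma rot_fixed_angle (u0 y0 th : R) :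
  0 < u0 ^ 2 + y0 ^ 2 -> rot_x u0 y0 th = u0 -> rot_y u0 y0 th = y0 ->
  0 < th -> 2 * PI <= th.
Proof.
intros H0 Hx Hy Hth. destruct (Rle_or_lt (2 * PI) th) as [h|h]; trivial. exfalso.
assert (Hs : 0 < sin (th / 2)) by (apply sin_gt_0; lra).
assert (Hc : cos th = 1 - 2 * sin (th / 2) * sin (th / 2)).
{ rewrite <- cos_2a_sin. f_equal. field. }
assert (E : (u0 ^ 2 + y0 ^ 2) * cos th = u0 ^ 2 + y0 ^ 2).
{ unfold rot_x in Hx. unfold rot_y in Hy.
  replace ((u0 ^ 2 + y0 ^ 2) * cos th) with
    (u0 * (u0 * cos th + y0 * sin th) + y0 * (y0 * cos th - u0 * sin th)) by ring.
  rewrite Hx, Hy. ring. }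
rewrite Hc in E. assert (0 < sin (th / 2) * sin (th / 2)) by now apply Rmult_lt_0_compat.
nra.
Qed.

(** The last equation is the derivative of [G (phi u) = u ^ 2 / 2]. The bound [/ 2 <= dphi u] makes
    [phi] injective and lets time be inverted as a function of the angle. *)
Definition energy_chart (g phi dphi : R -> R) (rho : R) : Prop :=
  0 < rho /\ phi 0 = 0 /\
  forall u, Rabs u < rho ->
    is_derive phi u (dphi u) /\ continuous dphi u /\ / 2 <= dphi u /\ g (phi u) * dphi u = u.

Lemma energy_chart_incr (g phi dphi : R -> R) (rho u v : R) :
  energy_chart g phi dphi rho -> - rho < u -> u <= v -> v < rho ->
  / 2 * (v - u) <= phi v - phi u.
Proof.
intros (Hr & _ & H) Hu Huv Hv.
apply bounded_derive_incr with dphi; trivial;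
  intros x Hx; apply H; apply Rabs_def1; lra.
Qed.

Lemma energy_chart_inj (g phi dphi : R -> R) (rho u v : R) :
  energy_chart g phi dphi rho -> Rabs u < rho -> Rabs v < rho -> phi u = phi v -> u = v.
Proof.
intros H Hu Hv E. apply Rabs_def2 in Hu, Hv.
destruct (Rle_or_lt u v) as [h|h].
- assert (hh := energy_chart_incr g phi dphi rho u v H). lra.
- assert (hh := energy_chart_incr g phi dphi rho v u H). lra.
Qed.

(* In the plane of [(u, y)] with [x = phi u] the flow is a rotation whose angle
   [th] satisfies [dt = dphi (rot_x u0 y0 th) dth]. *)
Definition is_time_of_angle (dphi : R -> R) (u0 y0 : R) (Ph : R -> R) : Prop :=
  Ph 0 = 0 /\ forall th, is_derive Ph th (dphi (rot_x u0 y0 th)).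

Lemma ex_time_of_angle (g phi dphi : R -> R) (rho u0 y0 : R) :
  energy_chart g phi dphi rho -> u0 ^ 2 + y0 ^ 2 < rho ^ 2 ->
  exists Ph, is_time_of_angle dphi u0 y0 Ph.
Proof.
intros (Hr & _ & H) Huy.
exists (primitive0 (fun th => dphi (rot_x u0 y0 th))). split.
- apply (RInt_point 0 (fun th => dphi (rot_x u0 y0 th))).
- apply (is_derive_primitive0 (fun th => dphi (rot_x u0 y0 th))). intros th.
  apply (continuous_comp (rot_x u0 y0) dphi).
  + apply (ex_derive_continuous (rot_x u0 y0)). eexists. apply is_derive_rot_x.
  + apply H. now apply rot_x_lt.
Qed.

(** Since [g (phi u) = u / dphi u], the field in the plane of [(u, y)] is that of the rotation
    divided by [dphi u]: the orbits are the same and only the clock changes. One turn takes the time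
    [Ph (2 * PI)]. *)
Theorem energy_chart_periodic_solution (g phi dphi Ph : R -> R) (rho u0 y0 : R) :
  energy_chart g phi dphi rho -> 0 < u0 ^ 2 + y0 ^ 2 < rho ^ 2 ->
  is_time_of_angle dphi u0 y0 Ph ->
  exists x y, is_solution g x y /\ x 0 = phi u0 /\ y 0 = y0 /\
    is_minimal_period x y (Ph (2 * PI)).
Proof.
intros Hch [Huy0 Huy] [Ph0 HPh].
assert (Hch' := Hch). destruct Hch' as (Hr & Hphi0 & H).
assert (Hv : forall th, Rabs (rot_x u0 y0 th) < rho) by (intros th; now apply rot_x_lt).
destruct (global_inverse Ph (fun th => dphi (rot_x u0 y0 th)) (/ 2)) as (Th & HPT & HTP & HTh); trivial.
{ lra. }
{ intros th. now apply H. }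
assert (Hincr : forall s t, s <= t -> / 2 * (t - s) <= Ph t - Ph s).
{ intros s t. apply bounded_derive_incr with (fun th => dphi (rot_x u0 y0 th)); trivial.
  intros th _. now apply H. }
assert (HPI := PI_RGT_0).
(* The derivative of [Ph] is periodic, so the increment over one turn is constant. *)
assert (Hper : forall th, Ph (th + 2 * PI) = Ph th + Ph (2 * PI)).
{ intros th.
  assert (E := is_derive_0_const (fun s => Ph (s + 2 * PI) - Ph s)).
  assert (E1 : Ph (th + 2 * PI) - Ph th = Ph (0 + 2 * PI) - Ph 0).
  { apply E. intros s.
    replace 0 with (dphi (rot_x u0 y0 (s + 2 * PI)) * (1 + 0) - dphi (rot_x u0 y0 s))
      by (rewrite rot_x_2PI; ring).
    apply (is_derive_minus (fun s => Ph (s + 2 * PI)) Ph); [|apply HPh].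
    apply (is_derive_comp_R Ph (fun s => s + 2 * PI)); [apply HPh|].
    auto_derive; trivial; ring. }
  rewrite Rplus_0_l, Ph0 in E1. lra. }
assert (HT : Th 0 = 0) by (rewrite <- Ph0 at 1; apply HTP).
exists (fun t => phi (rot_x u0 y0 (Th t))), (fun t => rot_y u0 y0 (Th t)).
split; [|split; [|split]].
- intros t. destruct (H (rot_x u0 y0 (Th t)) (Hv _)) as (h1 & _ & h2 & h3). split.
  + replace (rot_y u0 y0 (Th t)) with
      (dphi (rot_x u0 y0 (Th t)) * (rot_y u0 y0 (Th t) * / dphi (rot_x u0 y0 (Th t)))) by (field; lra).
    apply (is_derive_comp_R phi (fun t => rot_x u0 y0 (Th t))); trivial.
    apply (is_derive_comp_R (rot_x u0 y0) Th); [apply is_derive_rot_x | apply HTh].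
  + replace (- g (phi (rot_x u0 y0 (Th t)))) with
      (- rot_x u0 y0 (Th t) * / dphi (rot_x u0 y0 (Th t))) by (rewrite <- h3 at 1; field; lra).
    apply (is_derive_comp_R (rot_y u0 y0) Th); [apply is_derive_rot_y | apply HTh].
- now rewrite HT, rot_x_0.
- now rewrite HT, rot_y_0.
- split; [split|].
  + specialize (Hincr 0 (2 * PI)). lra.
  + intros t.
    assert (E : Th (t + Ph (2 * PI)) = Th t + 2 * PI).
    { rewrite <- (HTP (Th t + 2 * PI)). now rewrite Hper, HPT. }
    now rewrite E, rot_x_2PI, rot_y_2PI.
  (* After a period [S] the rotation by the positive angle [Th S] is back at its initial point, by
     injectivity of [phi]; the angle is then at least a full turn, and [Ph] is increasing. *)
  + intros S [HS HSper]. destruct (HSper 0) as [E1 E2].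
    rewrite Rplus_0_l, HT in E1, E2.
    assert (HTS : 0 < Th S).
    { destruct (Rlt_or_le 0 (Th S)) as [h|h]; trivial.
      specialize (Hincr _ _ h). rewrite HPT in Hincr. lra. }
    apply (energy_chart_inj g phi dphi rho) in E1; trivial.
    rewrite rot_x_0 in E1. rewrite rot_y_0 in E2.
    assert (h := rot_fixed_angle u0 y0 (Th S) Huy0 E1 E2 HTS).
    specialize (Hincr _ _ h). rewrite HPT in Hincr. lra.
Qed.

(** * Zeros of power series and uniqueness of solutions *)

Lemma CV_radius_decr_n (a : nat -> R) (n : nat) : CV_radius (PS_decr_n a n) = CV_radius a.
Proof.
induction n as [|n IH].
- apply CV_radius_ext. reflexivity.
- rewrite <- IH, <- (CV_radius_decr_1 (PS_decr_n a n)). apply CV_radius_ext.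
  intros k. unfold PS_decr_n, PS_decr_1. f_equal. lia.
Qed.

Lemma ex_pos_lt_CV_radius (a : nat -> R) :
  Rbar_lt 0 (CV_radius a) -> exists r, 0 < r /\ Rbar_lt r (CV_radius a).
Proof.
destruct (CV_radius a) as [l| |]; simpl; intros H.
- exists (l / 2). lra.
- exists 1. split; [lra|trivial].
- contradiction.
Qed.

Lemma first_nonzero_coef (d : nat -> R) :
  (forall n, d n = 0) \/ exists n, d n <> 0 /\ forall k, (k < n)%nat -> d k = 0.
Proof.
destruct (Classical_Prop.classic (exists n, d n <> 0)) as [[n Hn]|H].
- right. revert Hn. induction n as [n IH] using lt_wf_ind. intros Hn.
  destruct (Classical_Prop.classic (exists k, (k < n)%nat /\ d k <> 0)) as [[k [Hk1 Hk2]]|h].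
  + now apply (IH k).
  + exists n. split; trivial. intros k Hk. destruct (Req_dec (d k) 0) as [h0|h0]; trivial.
    exfalso. apply h. now exists k.
- left. intros n. destruct (Req_dec (d n) 0) as [h0|h0]; trivial.
  exfalso. apply H. now exists n.
Qed.

(** Dividing by [w ^ n], with [n] the order of the series, leaves a function continuous at 0 whose
    value there is [d n], so it keeps the sign of [d n] nearby. *)
Lemma PSeries_sign (d : nat -> R) :
  Rbar_lt 0 (CV_radius d) ->
  (forall n, d n = 0) \/
  exists e, 0 < e /\ ((forall w, 0 < w < e -> 0 < PSeries d w) \/
                      (forall w, 0 < w < e -> PSeries d w < 0)).
Proof.
intros Hd. destruct (first_nonzero_coef d) as [H|[n [Hn H]]]; [now left|right].
destruct (ex_pos_lt_CV_radius d Hd) as (r & Hr & Hrd).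
assert (Hc : continuous (PSeries (PS_decr_n d n)) 0).
{ apply continuous_PSeries with r; [now rewrite CV_radius_decr_n|]. rewrite Rabs_R0. lra. }
assert (H0 : PSeries (PS_decr_n d n) 0 = d n).
{ rewrite PSeries_0. unfold PS_decr_n. f_equal. lia. }
assert (Habs : 0 < Rabs (d n)) by now apply Rabs_pos_lt.
destruct (proj1 (filterlim_locally _ _) Hc (mkposreal _ Habs)) as [e He].
exists e. split; [apply cond_pos|].
assert (He' : forall w, 0 < w < e -> Rabs (PSeries (PS_decr_n d n) w - d n) < Rabs (d n)).
{ intros w Hw. rewrite <- H0 at 1. apply He. change (Rabs (w - 0) < e).
  rewrite Rminus_0_r, Rabs_pos_eq; lra. }
destruct (Rlt_or_le 0 (d n)) as [hn|hn]; [left|right]; intros w Hw;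
  specialize (He' w Hw); rewrite (PSeries_decr_n_aux d n w H);
  assert (Hp : 0 < w ^ n) by (apply pow_lt; lra).
- rewrite (Rabs_pos_eq (d n)) in He' by lra. apply Rabs_def2 in He'.
  apply Rmult_lt_0_compat; lra.
- rewrite (Rabs_left (d n)) in He' by lra. apply Rabs_def2 in He'. nra.
Qed.

Lemma PSeries_eq_0_right (d : nat -> R) (e : R) :
  Rbar_lt 0 (CV_radius d) -> 0 < e -> (forall w, 0 < w < e -> PSeries d w = 0) ->
  forall n, d n = 0.
Proof.
intros Hd He H. destruct (PSeries_sign d Hd) as [h|(e' & He' & h)]; trivial. exfalso.
set (w := Rmin e e' / 2).
assert (Hw : 0 < w < e /\ 0 < w < e').
{ assert (h1 := Rmin_l e e'). assert (h2 := Rmin_r e e'). assert (h3 := Rmin_pos e e' He He').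
  unfold w. lra. }
destruct Hw as [Hw1 Hw2]. specialize (H w Hw1).
destruct h as [h|h]; specialize (h w Hw2); lra.
Qed.

Lemma analytic_at_locally_Lipschitz (g : R -> R) :
  analytic_at g 0 -> exists r L, 0 < r /\ 0 <= L /\
    forall x1 x2, Rabs x1 <= r -> Rabs x2 <= r -> Rabs (g x1 - g x2) <= L * Rabs (x1 - x2).
Proof.
intros Hg. destruct (analytic_at_PSeries g 0 Hg) as (a & r & Hr & Hc & E).
destruct (l1_norm_bounded r (PS_derive a)) as [M HM]; [lra|now rewrite CV_radius_derive|].
exists r, M. split; trivial. split.
{ apply Rle_trans with (2 := HM 0%nat). apply l1_norm_nonneg. lra. }
intros x1 x2 H1 H2. rewrite !E by (rewrite Rminus_0_r; trivial). rewrite !Rminus_0_r.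
assert (Hin : forall x, Rmin x2 x1 <= x <= Rmax x2 x1 -> Rabs x <= r).
{ intros x Hx. apply Rabs_le. apply Rabs_le_between in H1, H2. revert Hx.
  unfold Rmin, Rmax. destruct Rle_dec; lra. }
destruct (MVT_gen (PSeries a) x2 x1 (PSeries (PS_derive a))) as (c & Hc' & Ec).
- intros x Hx. apply is_derive_PSeries. apply Rbar_lt_CV_radius with r; trivial. apply Hin. lra.
- intros x Hx. apply continuity_pt_filterlim. apply continuous_PSeries with r; auto.
- rewrite Ec, Rabs_mult. apply Rmult_le_compat_r; [apply Rabs_pos|].
  apply PSeries_Rabs_le with r; auto.
Qed.

(** [D s * exp (- K * s)] is nonincreasing and [D s * exp (K * s)] nondecreasing. Comparison with
    time 0 uses the first for positive times and the second for negative times. *)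
Lemma gronwall_zero (D dD : R -> R) (K : R) :
  (forall t, 0 <= D t) -> D 0 = 0 -> (forall t, is_derive D t (dD t)) ->
  (forall t, Rabs (dD t) <= K * D t) -> forall t, D t = 0.
Proof.
intros Hpos H0 HD HK t.
assert (Hder : forall s k, is_derive (fun s => D s * exp (k * s)) s ((dD s + k * D s) * exp (k * s))).
{ intros s k. evar_last.
  - apply (is_derive_mult D (fun s => exp (k * s)) s (dD s) (k * exp (k * s))); [apply HD| |apply Rmult_comm].
    auto_derive; trivial. ring.
  - unfold plus, mult; simpl. ring. }
assert (Hz : forall k, D t * exp (k * t) <= 0 -> D t = 0).
{ intros k h. assert (he := exp_pos (k * t)). specialize (Hpos t).
  destruct Hpos as [hp|hp]; [|now symmetry].
  assert (0 < D t * exp (k * t)) by now apply Rmult_lt_0_compat. lra. }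
destruct (Rle_or_lt 0 t) as [ht|ht].
- apply (Hz (- K)).
  assert (h := bounded_derive_incr (fun s => - (D s * exp (- K * s)))
    (fun s => - ((dD s + - K * D s) * exp (- K * s))) 0 0 t).
  assert (h' : 0 * (t - 0) <= - (D t * exp (- K * t)) - - (D 0 * exp (- K * 0))).
  { apply h; trivial.
    - intros s _. apply (is_derive_opp (fun s => D s * exp (- K * s))), Hder.
    - intros s _. assert (he := exp_pos (- K * s)). specialize (HK s).
      apply Rabs_le_between in HK. nra. }
  rewrite H0 in h'. lra.
- apply (Hz K).
  assert (h := bounded_derive_incr (fun s => D s * exp (K * s))
    (fun s => (dD s + K * D s) * exp (K * s)) 0 t 0).
  assert (h' : 0 * (0 - t) <= D 0 * exp (K * 0) - D t * exp (K * t)).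
  { apply h; [|intros s _|lra].
    - intros s _. apply Hder.
    - assert (he := exp_pos (K * s)). specialize (HK s).
      apply Rabs_le_between in HK. nra. }
  rewrite H0 in h'. lra.
Qed.

(** Gronwall for the squared distance. The Lipschitz bound being local, both solutions are supposed
    to stay within its range for all times. *)
Lemma solution_unique (g x1 y1 x2 y2 : R -> R) (r L : R) :
  0 <= L ->
  (forall a b, Rabs a <= r -> Rabs b <= r -> Rabs (g a - g b) <= L * Rabs (a - b)) ->
  is_solution g x1 y1 -> is_solution g x2 y2 ->
  (forall t, Rabs (x1 t) <= r) -> (forall t, Rabs (x2 t) <= r) ->
  x1 0 = x2 0 -> y1 0 = y2 0 -> forall t, x1 t = x2 t /\ y1 t = y2 t.
Proof.
intros HL0 HL S1 S2 B1 B2 Ex Ey.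
assert (H : forall t, (x1 t - x2 t) ^ 2 + (y1 t - y2 t) ^ 2 = 0).
{ apply (gronwall_zero _ (fun t => 2 * (x1 t - x2 t) * (y1 t - y2 t) +
      2 * (y1 t - y2 t) * (- g (x1 t) - - g (x2 t))) (1 + L)).
  - intros t. apply Rplus_le_le_0_compat; apply pow2_ge_0.
  - rewrite Ex, Ey. ring.
  - intros t. destruct (S1 t) as [a1 b1], (S2 t) as [a2 b2].
    assert (Hx := is_derive_minus x1 x2 t _ _ a1 a2).
    assert (Hy := is_derive_minus y1 y2 t _ _ b1 b2).
    evar_last.
    + apply (is_derive_plus (fun t => (x1 t - x2 t) ^ 2) (fun t => (y1 t - y2 t) ^ 2)).
      * apply (is_derive_pow (fun t => x1 t - x2 t) 2 t _ Hx).
      * apply (is_derive_pow (fun t => y1 t - y2 t) 2 t _ Hy).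
    + unfold plus, minus, opp; simpl. unfold plus; simpl. ring.
  - intros t. specialize (HL (x1 t) (x2 t) (B1 t) (B2 t)).
    set (X := x1 t - x2 t) in *. set (Y := y1 t - y2 t).
    replace (- g (x1 t) - - g (x2 t)) with (- (g (x1 t) - g (x2 t))) by ring.
    set (W := g (x1 t) - g (x2 t)) in *.
    (* This equals [(1 + L)] times [2 * Rabs X * Rabs Y], and
       [2 * Rabs X * Rabs Y <= X ^ 2 + Y ^ 2]. *)
    apply Rle_trans with (2 * (Rabs X * Rabs Y) + 2 * (Rabs Y * (L * Rabs X))).
    + apply Rle_trans with (1 := Rabs_triang _ _). apply Rplus_le_compat.
      * rewrite !Rabs_mult, (Rabs_pos_eq 2) by lra. lra.
      * rewrite !Rabs_mult, (Rabs_pos_eq 2), Rabs_Ropp by lra. rewrite Rmult_assoc.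
        apply Rmult_le_compat_l; [lra|]. apply Rmult_le_compat_l; [apply Rabs_pos|trivial].
    + rewrite <- (pow2_abs X), <- (pow2_abs Y).
      assert (0 <= (1 + L) * (Rabs X - Rabs Y) ^ 2) by (apply Rmult_le_pos; [lra|apply pow2_ge_0]).
      lra. }
intros t. specialize (H t).
assert (h1 := pow2_ge_0 (x1 t - x2 t)). assert (h2 := pow2_ge_0 (y1 t - y2 t)).
split; apply Rminus_diag_uniq; apply Rsqr_0_uniq; unfold Rsqr; lra.
Qed.

Lemma energy_conservation (g x y : R -> R) :
  (forall z, continuous g z) -> is_solution g x y ->
  forall t, y t ^ 2 / 2 + primitive0 g (x t) = y 0 ^ 2 / 2 + primitive0 g (x 0).
Proof.
intros Hg S t. apply (is_derive_0_const (fun t => y t ^ 2 / 2 + primitive0 g (x t))).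
intros s. destruct (S s) as [a b]. evar_last.
- apply (is_derive_plus (fun t => y t ^ 2 / 2) (fun t => primitive0 g (x t))).
  + apply (is_derive_comp_R (fun z => z ^ 2 / 2) y s (y s)); [|exact b].
    auto_derive; trivial. field.
  + apply (is_derive_comp_R (primitive0 g) x); [now apply is_derive_primitive0 | apply a].
- unfold plus; simpl. ring.
Qed.

(** A potential barrier: leaving the interval means passing through an endpoint, by the intermediate
    value theorem, where the potential alone exceeds the conserved energy. *)
Lemma solution_confined (g x y : R -> R) (lo hi mu : R) :
  (forall z, continuous g z) -> is_solution g x y ->
  mu <= primitive0 g lo -> mu <= primitive0 g hi ->
  lo < x 0 < hi -> y 0 ^ 2 / 2 + primitive0 g (x 0) < mu ->
  forall t, lo < x t < hi.
Proof.
intros Hg S Hlo Hhi H0 HE t.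
assert (Hcont : forall t, continuity_pt x t).
{ intros s. apply continuity_pt_filterlim. apply (ex_derive_continuous x). eexists. apply S. }
assert (Hne : forall s z, mu <= primitive0 g z -> x s <> z).
{ intros s z Hz E. assert (h := energy_conservation g x y Hg S s). rewrite E in h.
  assert (h2 := pow2_ge_0 (y s)). lra. }
split.
- destruct (Rlt_or_le lo (x t)) as [h|h]; trivial. exfalso.
  destruct (IVT_gen x 0 t lo Hcont) as (s & _ & Es).
  + split; [apply Rle_trans with (1 := Rmin_r _ _) | apply Rle_trans with (2 := Rmax_l _ _)]; lra.
  + now apply (Hne s lo).
- destruct (Rlt_or_le (x t) hi) as [h|h]; trivial. exfalso.
  destruct (IVT_gen x 0 t hi Hcont) as (s & _ & Es).
  + split; [apply Rle_trans with (1 := Rmin_l _ _) | apply Rle_trans with (2 := Rmax_r _ _)]; lra.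
  + now apply (Hne s hi).
Qed.

(** * Even power series as functions of the energy *)

Lemma CV_radius_even_part (a : nat -> R) (r : R) :
  0 < r -> Rbar_lt r (CV_radius a) -> Rbar_le (r ^ 2) (CV_radius (fun n => a (2 * n)%nat)).
Proof.
intros Hr Ha. destruct (l1_norm_bounded r a) as [M HM]; [lra|trivial|].
apply (proj1 (CV_radius_bounded _)). exists M. intros n.
rewrite <- pow_mult, Rabs_mult, <- RPow_abs, (Rabs_pos_eq r) by lra.
apply Rle_trans with (2 := HM (2 * n)%nat).
apply (term_le_partial_sum (fun k => Rabs (a k) * r ^ k)).
intros k. apply l1_norm_term_nonneg. lra.
Qed.

Lemma CV_radius_odd_part (a : nat -> R) (r : R) :
  0 < r -> Rbar_lt r (CV_radius a) -> Rbar_le (r ^ 2) (CV_radius (fun n => a (2 * n + 1)%nat)).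
Proof.
intros Hr Ha.
rewrite (CV_radius_ext _ (fun n => PS_decr_1 a (2 * n)%nat)).
- apply CV_radius_even_part; trivial. now rewrite CV_radius_decr_1.
- intros n. unfold PS_decr_1. f_equal. lia.
Qed.

Lemma sqr_lt_CV (r u : R) (a : nat -> R) :
  Rabs u < r -> Rbar_le (r ^ 2) (CV_radius a) -> Rbar_lt (Rabs (u ^ 2)) (CV_radius a).
Proof.
intros Hu H. apply Rbar_lt_le_trans with (2 := H). change (Rabs (u ^ 2) < r ^ 2).
rewrite <- RPow_abs. assert (h := Rabs_pos u). nra.
Qed.

Lemma PSeries_even_odd (a : nat -> R) (r u : R) :
  Rabs u < r -> Rbar_lt r (CV_radius a) ->
  PSeries a u = PSeries (fun n => a (2 * n)%nat) (u ^ 2) +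
            u * PSeries (fun n => a (2 * n + 1)%nat) (u ^ 2).
Proof.
intros Hu Ha. assert (h := Rabs_pos u).
apply PSeries_odd_even; apply CV_radius_inside; apply sqr_lt_CV with r; trivial.
- apply CV_radius_even_part; trivial; lra.
- apply CV_radius_odd_part; trivial; lra.
Qed.

Lemma is_pseries_half_square (b q : nat -> R) (u : R) :
  (forall n, q (2 * n)%nat = b n * (/ 2) ^ n) -> (forall n, q (2 * n + 1)%nat = 0) ->
  ex_pseries b (u ^ 2 / 2) -> is_pseries q u (PSeries b (u ^ 2 / 2)).
Proof.
intros He Ho Hex.
replace (PSeries b (u ^ 2 / 2)) with (PSeries b (u ^ 2 / 2) + u * 0) by ring.
apply is_pseries_odd_even.
- apply is_pseries_R. apply (is_series_ext (fun n => b n * (u ^ 2 / 2) ^ n)).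
  + intros n. change (b n * (u ^ 2 / 2) ^ n = q (2 * n)%nat * (u ^ 2) ^ n).
    rewrite He. unfold Rdiv. rewrite Rpow_mult_distr. ring.
  + apply is_pseries_R. now apply PSeries_correct.
- apply is_pseries_R. apply (is_series_ext (fun n => 0 * 1)).
  + intros n. change (0 * 1 = q (2 * n + 1)%nat * (u ^ 2) ^ n). rewrite Ho. ring.
  + rewrite <- (Rmult_0_l (Series (fun _ => 1))).
    apply filterlim_ext with (fun _ => 0); [|rewrite Rmult_0_l; apply filterlim_const].
    intros n. rewrite sum_n_const. ring.
Qed.

Lemma sqrt_double_small (s r : R) : 0 < s -> s < r ^ 2 / 2 -> 0 < r -> 0 < sqrt (2 * s) < r.
Proof.
intros Hs H Hr. split; [apply sqrt_lt_R0; lra|].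
rewrite <- (sqrt_pow2 r) by lra. apply sqrt_lt_1; lra.
Qed.

Lemma sqrt_double_sqr (s : R) : 0 < s -> sqrt (2 * s) ^ 2 = 2 * s.
Proof. intros Hs. apply pow2_sqrt. lra. Qed.

Lemma at_right_0_iff (P : R -> Prop) :
  at_right 0 P <-> exists e, 0 < e /\ forall s, 0 < s < e -> P s.
Proof.
split.
- intros [e He]. exists e. split; [apply cond_pos|]. intros s Hs. apply He; [|lra].
  change (Rabs (s - 0) < e). rewrite Rminus_0_r, Rabs_pos_eq; lra.
- intros (e & He & H). exists (mkposreal e He). intros s Hs Hs0.
  change (Rabs (s - 0) < e) in Hs. rewrite Rminus_0_r, Rabs_pos_eq in Hs by lra. apply H. lra.
Qed.

(** With [s = u ^ 2 / 2], the primitive becomes an even series [q] in [u] that agrees with [K] on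
    the left of 0; by the identity principle [K] and [q] have the same coefficients. *)
Lemma even_series_of_primitive (K : nat -> R) (f : R -> R) (r : R) :
  0 < r -> Rbar_lt r (CV_radius K) -> analytic_at f 0 ->
  at_right 0 (fun s => primitive0 f s = PSeries K (- sqrt (2 * s))) ->
  forall n, K (2 * n + 1)%nat = 0.
Proof.
intros Hr HK Hf HP.
destruct (analytic_at_PSeries f 0 Hf) as (a & r1 & Hr1 & Ha & Ef).
assert (EF := primitive0_PSeries f a r1 Ha
  ltac:(intros x Hx; rewrite Ef; rewrite Rminus_0_r; trivial)).
apply at_right_0_iff in HP. destruct HP as (e & He & HP).
set (b := PS_Int a) in EF.
assert (Hb : Rbar_lt r1 (CV_radius b)) by (unfold b; now rewrite CV_radius_Int).
pose (q := fun n => if Nat.even n then b (Nat.div2 n) * (/ 2) ^ Nat.div2 n else 0).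
assert (qe : forall n, q (2 * n)%nat = b n * (/ 2) ^ n).
{ intros n. unfold q. rewrite Nat.even_mul, Nat.div2_double. reflexivity. }
assert (qo : forall n, q (2 * n + 1)%nat = 0).
{ intros n. unfold q. rewrite Nat.even_add, Nat.even_mul. reflexivity. }
(* The bound 1 ensures [u ^ 2 / 2 < m] whenever [0 <= u <= m]. *)
set (m := Rmin r (Rmin r1 (Rmin e 1))).
assert (Hm : 0 < m <= r /\ m <= r1 /\ m <= e /\ m <= 1).
{ unfold m. split; [split|split; [|split]].
  - repeat apply Rmin_pos; trivial; lra.
  - apply Rmin_l.
  - apply Rle_trans with (1 := Rmin_r _ _), Rmin_l.
  - apply Rle_trans with (1 := Rmin_r _ _), Rle_trans with (1 := Rmin_r _ _), Rmin_l.
  - apply Rle_trans with (1 := Rmin_r _ _), Rle_trans with (1 := Rmin_r _ _), Rmin_r. }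
assert (Hsq : forall u, 0 <= u -> u <= m -> 0 <= u ^ 2 / 2 < m).
{ intros u h1 h2. assert (0 <= u * u <= m * 1) by (split; nra). lra. }
assert (Hq : forall u, Rabs u <= m -> is_pseries q u (PSeries b (u ^ 2 / 2))).
{ intros u Hu. apply is_pseries_half_square; trivial.
  apply CV_radius_inside. apply Rbar_lt_CV_radius with r1; trivial.
  rewrite <- (pow2_abs u). specialize (Hsq (Rabs u) (Rabs_pos u) Hu).
  rewrite Rabs_pos_eq; lra. }
assert (Hqm : Rbar_le m (CV_radius q)).
{ rewrite <- (Rabs_pos_eq m) by lra. apply CV_radius_ge_of_ex_pseries.
  eexists. apply Hq. rewrite Rabs_pos_eq; lra. }
(* The agreement holds at negative arguments; the signs reflect it to the right of 0, where
   [PSeries_eq_0_right] applies. *)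
pose (d n := (K n - q n) * (-1) ^ n).
assert (Hd0 : forall u, PSeries d u = PSeries (PS_minus K q) (- u)).
{ intros u. apply Series_ext. intros n. unfold d, PS_minus, PS_plus, PS_opp, plus, opp; simpl.
  replace (- u) with (-1 * u) by ring. rewrite Rpow_mult_distr. ring. }
assert (Hd : forall n, d n = 0).
{ apply (PSeries_eq_0_right d m).
  - apply Rbar_lt_le_trans with (Rabs (m / 2)).
    + simpl. rewrite Rabs_pos_eq; lra.
    + apply CV_radius_ge_of_ex_pseries.
      assert (Hex : ex_pseries (PS_minus K q) (- (m / 2))).
      { apply ex_pseries_minus.
        - apply CV_radius_inside. apply Rbar_lt_CV_radius with r; trivial.
          rewrite Rabs_Ropp, Rabs_pos_eq; lra.
        - eexists. apply Hq. rewrite Rabs_Ropp, Rabs_pos_eq; lra. }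
      apply ex_pseries_R. apply ex_pseries_R in Hex. apply ex_series_ext with (2 := Hex).
      intros n. unfold d, PS_minus, PS_plus, PS_opp, plus, opp; simpl.
      replace (- (m / 2)) with (-1 * (m / 2)) by ring. rewrite Rpow_mult_distr. ring.
  - lra.
  - intros w Hw. rewrite Hd0.
    assert (Hw' : Rabs (- w) <= m) by (rewrite Rabs_Ropp, Rabs_pos_eq; lra).
    rewrite PSeries_minus.
    + rewrite (is_pseries_unique _ _ _ (Hq (- w) Hw')).
      replace ((- w) ^ 2) with (w ^ 2) by ring.
      assert (h := Hsq w ltac:(lra) ltac:(lra)).
      assert (0 < w ^ 2 / 2) by (assert (0 < w ^ 2) by (apply pow_lt; lra); lra).
      fold b in EF. rewrite <- EF by (rewrite Rabs_pos_eq; lra).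
      rewrite HP by lra.
      replace (2 * (w ^ 2 / 2)) with (w ^ 2) by field. rewrite sqrt_pow2 by lra. ring.
    + apply CV_radius_inside. apply Rbar_lt_CV_radius with r; trivial. lra.
    + eexists. now apply Hq. }
intros n. specialize (Hd (2 * n + 1)%nat). unfold d in Hd. rewrite qo in Hd.
assert ((-1) ^ (2 * n + 1) <> 0) by (apply pow_nonzero; lra). nra.
Qed.

(** An even series in [v] is a series [b] in [s = v ^ 2 / 2], with coefficients [K (2 * n) * 2 ^ n],
    and [f] is its derivative. The condition on [K 0] matches the primitive vanishing at 0. *)
Lemma primitive_of_even_series (K : nat -> R) (r : R) :
  0 < r -> Rbar_lt r (CV_radius K) -> K 0%nat = 0 -> (forall n, K (2 * n + 1)%nat = 0) ->
  exists f, locally 0 (fun t => analytic_at f t) /\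
    at_right 0 (fun s => primitive0 f s = PSeries K (- sqrt (2 * s))).
Proof.
intros Hr HK K0 Hodd.
pose (b n := K (2 * n)%nat * 2 ^ n).
assert (Eb : forall s, PSeries b s = PSeries (fun n => K (2 * n)%nat) (2 * s)).
{ intros s. apply Series_ext. intros n. unfold b. rewrite Rpow_mult_distr. ring. }
assert (Hb : Rbar_le (r ^ 2 / 2) (CV_radius b)).
{ apply (proj1 (CV_radius_bounded _)).
  destruct (l1_norm_bounded r K) as [M HM]; [lra|trivial|]. exists M. intros n.
  apply Rle_trans with (2 := HM (2 * n)%nat).
  replace (b n * (r ^ 2 / 2) ^ n) with (K (2 * n)%nat * r ^ (2 * n)).
  - rewrite Rabs_mult, <- RPow_abs, (Rabs_pos_eq r) by lra.
    apply (term_le_partial_sum (fun k => Rabs (K k) * r ^ k)).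
    intros k. apply l1_norm_term_nonneg. lra.
  - unfold b. rewrite pow_mult. rewrite Rmult_assoc, <- Rpow_mult_distr. f_equal. f_equal. field. }
assert (Hr2 : 0 < r ^ 2) by (apply pow_lt; lra).
set (h := r ^ 2 / 4).
assert (Hbh : Rbar_lt h (CV_radius (PS_derive b))).
{ rewrite CV_radius_derive. apply Rbar_lt_le_trans with (2 := Hb). simpl. unfold h. lra. }
assert (Hh : 0 < h) by (unfold h; lra).
exists (PSeries (PS_derive b)). split.
- apply locally_Rabs with (h / 2); [lra|]. intros x Hx. rewrite Rminus_0_r in Hx.
  apply PSeries_analytic_at with h; trivial. lra.
- apply at_right_0_iff. exists h. split; trivial. intros s Hs.
  rewrite (primitive0_PSeries _ (PS_derive b) h); trivial; [|rewrite Rabs_pos_eq; lra].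
  rewrite (PSeries_ext _ b).
  2:{ intros [|n]; unfold PS_Int, PS_derive.
      - unfold b. simpl. rewrite K0. ring.
      - simpl pred. field. apply not_0_INR. lia. }
  assert (hs := sqrt_double_small s r ltac:(lra) ltac:(unfold h in Hs; lra) Hr).
  rewrite (PSeries_even_odd K r); trivial; [|rewrite Rabs_Ropp, Rabs_pos_eq; lra].
  replace ((- sqrt (2 * s)) ^ 2) with (sqrt (2 * s) ^ 2) by ring.
  rewrite sqrt_double_sqr by lra.
  rewrite (PSeries_ext (fun n => K (2 * n + 1)%nat) (fun _ => 0)) by trivial.
  rewrite PSeries_const_0, Eb. ring.
Qed.

Theorem even_series_iff_primitive (K : nat -> R) :
  Rbar_lt 0 (CV_radius K) -> K 0%nat = 0 ->
  (exists f, locally 0 (fun t => analytic_at f t) /\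
    at_right 0 (fun s => primitive0 f s = PSeries K (- sqrt (2 * s)))) <->
  (forall n, K (2 * n + 1)%nat = 0).
Proof.
intros HK K0. destruct (ex_pos_lt_CV_radius K HK) as (r & Hr & HrK). split.
- intros (f & Hf & HP). apply even_series_of_primitive with f r; trivial.
  now apply locally_singleton in Hf.
- intros H. now apply primitive_of_even_series with r.
Qed.

(** * The period *)

Lemma continuous_Rabs_lt (f : R -> R) (x0 e : R) :
  continuous f x0 -> 0 < e ->
  exists d, 0 < d /\ forall x, Rabs (x - x0) < d -> Rabs (f x - f x0) < e.
Proof.
intros Hf He. destruct (proj1 (filterlim_locally _ _) Hf (mkposreal e He)) as [d Hd].
exists d. split; [apply cond_pos|]. intros x Hx. apply (Hd x Hx).
Qed.

Lemma energy_parametrization_derive (g : R -> R) (p : nat -> R) (rho u : R) :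
  (forall x, continuous g x) -> Rbar_lt rho (CV_radius p) ->
  (forall u, Rabs u <= rho -> primitive0 g (PSeries p u) = u ^ 2 / 2) ->
  Rabs u < rho -> g (PSeries p u) * PSeries (PS_derive p) u = u.
Proof.
intros Hg Hp HG Hu.
assert (Hd : is_derive (fun u => primitive0 g (PSeries p u)) u
  (g (PSeries p u) * PSeries (PS_derive p) u)).
{ apply (is_derive_comp_R (primitive0 g) (PSeries p)); [now apply is_derive_primitive0|].
  apply is_derive_PSeries. apply Rbar_lt_CV_radius with rho; trivial. lra. }
rewrite <- (is_derive_unique _ _ _ Hd). apply is_derive_unique.
apply (is_derive_ext_loc (fun u => u ^ 2 / 2)).
- apply locally_Rabs with (rho - Rabs u); [lra|]. intros x Hx. symmetry. apply HG.
  replace x with (x - u + u) by ring. apply Rle_trans with (1 := Rabs_triang _ _). lra.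
- auto_derive; trivial. field.
Qed.

Theorem ex_energy_chart (g : R -> R) :
  (forall x, continuous g x) -> analytic_at g 0 -> g 0 = 0 -> is_derive g 0 1 ->
  exists (p : nat -> R) (rho : R),
    p 0%nat = 0 /\ p 1%nat = 1 /\ Rbar_lt rho (CV_radius p) /\
    energy_chart g (PSeries p) (PSeries (PS_derive p)) rho /\
    forall u, Rabs u <= rho -> primitive0 g (PSeries p u) = u ^ 2 / 2.
Proof.
intros Hc Hg g0 g1.
destruct (energy_parametrization g Hg g0 g1) as (p & rho & Hrho & p0 & p1 & Hp & HG).
assert (Hpd : Rbar_lt rho (CV_radius (PS_derive p))) by now rewrite CV_radius_derive.
(* The derivative equals [p 1 = 1] at 0, so it stays above [/ 2] on a smaller disc. *)
destruct (continuous_Rabs_lt (PSeries (PS_derive p)) 0 (/ 2)) as (d & Hd & Hd').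
{ apply continuous_PSeries with rho; trivial. rewrite Rabs_R0. lra. }
{ lra. }
set (rho' := Rmin rho d).
assert (Hr' : 0 < rho' <= rho /\ rho' <= d).
{ unfold rho'. split; [split|]; [now apply Rmin_pos|apply Rmin_l|apply Rmin_r]. }
exists p, rho'. split; trivial. split; trivial. split.
{ apply Rbar_le_lt_trans with (2 := Hp). simpl. lra. }
split; [split; [lra|split]|].
- now rewrite PSeries_0.
- intros u Hu. split; [|split; [|split]].
  + apply is_derive_PSeries. apply Rbar_lt_CV_radius with rho; trivial. lra.
  + apply continuous_PSeries with rho; trivial. lra.
  + specialize (Hd' u). rewrite Rminus_0_r in Hd'. specialize (Hd' ltac:(lra)).
    replace (PSeries (PS_derive p) 0) with 1 in Hd'.
    * apply Rabs_def2 in Hd'. lra.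
    * rewrite PSeries_0. unfold PS_derive. rewrite p1. simpl. ring.
  + apply energy_parametrization_derive with rho; trivial. lra.
- intros u Hu. apply HG. lra.
Qed.

(* Even part of [dphi] without its constant term [1]: in the plane of [(u, y)]
   it measures by how much the period exceeds [2 PI]. *)
Definition period_defect (p : nat -> R) : nat -> R :=
  PS_incr_1 (PS_decr_1 (fun n => PS_derive p (2 * n))).

Lemma CV_radius_period_defect (p : nat -> R) (rho : R) :
  0 < rho -> Rbar_lt rho (CV_radius p) -> Rbar_le (rho ^ 2) (CV_radius (period_defect p)).
Proof.
intros Hr Hp. unfold period_defect. rewrite CV_radius_incr_1, CV_radius_decr_1.
apply CV_radius_even_part; trivial. now rewrite CV_radius_derive.
Qed.

Lemma dphi_even_part (p : nat -> R) (rho v : R) :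
  p 1%nat = 1 -> Rbar_lt rho (CV_radius p) -> Rabs v < rho ->
  PSeries (PS_derive p) v + PSeries (PS_derive p) (- v) = 2 + 2 * PSeries (period_defect p) (v ^ 2).
Proof.
intros p1 Hp Hv. assert (h := Rabs_pos v).
assert (Hpd : Rbar_lt rho (CV_radius (PS_derive p))) by now rewrite CV_radius_derive.
rewrite (PSeries_even_odd _ rho v), (PSeries_even_odd _ rho (- v)); trivial;
  [|now rewrite Rabs_Ropp].
replace ((- v) ^ 2) with (v ^ 2) by ring.
unfold period_defect. rewrite PSeries_incr_1.
rewrite (PSeries_decr_1 (fun n => PS_derive p (2 * n))).
- replace (PS_derive p (2 * 0)) with 1; [ring|]. unfold PS_derive. simpl. rewrite p1. ring.
- apply CV_radius_inside. apply sqr_lt_CV with rho; trivial. apply CV_radius_even_part; trivial. lra.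
Qed.

(* Half a turn maps [v] to [- v], so that [Ph (th + PI) + Ph th - 2 th] only sees
   the even part of [dphi]. *)
Lemma time_of_angle_2PI (g : R -> R) (p : nat -> R) (rho u0 y0 : R) (Ph : R -> R) :
  p 1%nat = 1 -> Rbar_lt rho (CV_radius p) -> 0 < rho -> u0 ^ 2 + y0 ^ 2 < rho ^ 2 ->
  is_time_of_angle (PSeries (PS_derive p)) u0 y0 Ph ->
  exists th, 0 < th < PI /\
    Ph (2 * PI) = 2 * PI * (1 + PSeries (period_defect p) (rot_x u0 y0 th ^ 2)).
Proof.
intros p1 Hp Hr Huy [Ph0 HPh]. assert (HPI := PI_RGT_0).
destruct (MVT_cor2 (fun th => Ph (th + PI) + Ph th - 2 * th)
  (fun th => 2 * PSeries (period_defect p) (rot_x u0 y0 th ^ 2)) 0 PI) as (th & E & Hth); trivial.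
- intros th _. apply is_derive_Reals.
  assert (Hv := rot_x_lt u0 y0 rho th Hr Huy).
  assert (h := dphi_even_part p rho _ p1 Hp Hv).
  replace (2 * PSeries (period_defect p) (rot_x u0 y0 th ^ 2)) with
    (PSeries (PS_derive p) (rot_x u0 y0 (th + PI)) * 1 + PSeries (PS_derive p) (rot_x u0 y0 th) - 2)
    by (rewrite rot_x_PI; lra).
  apply (is_derive_minus (fun th => Ph (th + PI) + Ph th) (fun th => 2 * th)).
  + apply (is_derive_plus (fun th => Ph (th + PI)) Ph); [|apply HPh].
    apply (is_derive_comp_R Ph (fun th => th + PI)); [apply HPh|]. auto_derive; trivial; ring.
  + auto_derive; trivial; ring.
- exists th. split; trivial.
  (* Between the two ends [Ph PI] cancels, which leaves [Ph (2 * PI) - 2 * PI]. *)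
  replace (PI + PI) with (2 * PI) in E by ring. rewrite Rplus_0_l, Ph0 in E. lra.
Qed.

(** As [phi] expands distances by at least [/ 2], a point with [Rabs x0 < eta / 4] has a preimage in
    [[- eta / 2, eta / 2]]; adding [y0 ^ 2 < (eta / 4) ^ 2] stays below [eta ^ 2]. *)
Lemma energy_chart_initial_point (g phi dphi : R -> R) (rho eta x0 y0 : R) :
  energy_chart g phi dphi rho -> 0 < eta < rho -> in_punctured_disc (eta / 4) x0 y0 ->
  exists u0, phi u0 = x0 /\ 0 < u0 ^ 2 + y0 ^ 2 < eta ^ 2.
Proof.
intros Hch Heta [Hd0 Hd].
assert (Hnn : 0 <= x0 ^ 2 + y0 ^ 2) by (apply Rplus_le_le_0_compat; apply pow2_ge_0).
assert (Hpos : 0 < x0 ^ 2 + y0 ^ 2).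
{ destruct Hnn as [h|h]; trivial. rewrite <- h, sqrt_0 in Hd0. lra. }
assert (Hsm : x0 ^ 2 + y0 ^ 2 < (eta / 4) ^ 2).
{ rewrite <- (pow2_sqrt (x0 ^ 2 + y0 ^ 2)) by trivial. nra. }
assert (hx2 := pow2_ge_0 x0). assert (hy2 := pow2_ge_0 y0).
assert (Hx : Rabs x0 < eta / 4).
{ rewrite <- (Rabs_pos_eq (eta / 4)) by lra. apply Rsqr_lt_abs_0. unfold Rsqr. lra. }
apply Rabs_def2 in Hx.
assert (Hch' := Hch). destruct Hch' as (Hr & Hphi0 & H).
assert (h1 := energy_chart_incr g phi dphi rho 0 (eta / 2) Hch).
assert (h2 := energy_chart_incr g phi dphi rho (- (eta / 2)) 0 Hch).
rewrite Hphi0 in h1, h2.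
destruct (IVT_interv (fun u => phi u - x0) (- (eta / 2)) (eta / 2)) as (u0 & Hu0 & E); try lra.
- intros u Hu. apply continuity_pt_filterlim.
  apply (ex_derive_continuous (fun u => phi u - x0)).
  exists (minus (dphi u) 0). apply (is_derive_minus phi (fun _ => x0)).
  + apply H. apply Rabs_def1; lra.
  + apply (is_derive_const x0).
- assert (E' : phi u0 = x0) by lra.
  exists u0. split; trivial.
  assert (hu2 := pow2_ge_0 u0). split.
  + destruct (Req_dec u0 0) as [h|h].
    * rewrite h, Hphi0 in E'. subst x0 u0. lra.
    * assert (0 < u0 ^ 2) by (rewrite <- Rsqr_pow2; now apply Rlt_0_sqr). lra.
  + assert (u0 ^ 2 <= (eta / 2) ^ 2).
    { rewrite <- (pow2_abs u0). apply pow_incr. split; [apply Rabs_pos|]. apply Rabs_le. lra. }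
    nra.
Qed.

Lemma energy_chart_is_center (g phi dphi : R -> R) (rho : R) :
  g 0 = 0 -> energy_chart g phi dphi rho -> is_center g.
Proof.
intros g0 Hch. split; trivial. assert (Hr := proj1 Hch).
exists (rho / 2 / 4). split; [lra|]. intros x0 y0 Hd.
destruct (energy_chart_initial_point g phi dphi rho (rho / 2) x0 y0 Hch) as (u0 & Eu & Hu0 & Hu);
  trivial; [lra|].
assert (Hu' : u0 ^ 2 + y0 ^ 2 < rho ^ 2) by nra.
destruct (ex_time_of_angle g phi dphi rho u0 y0 Hch Hu') as [Ph HPh].
destruct (energy_chart_periodic_solution g phi dphi Ph rho u0 y0 Hch (conj Hu0 Hu') HPh)
  as (x & y & S & Ex & Ey & HT).
exists x, y. split; trivial. split; [now rewrite Ex|]. split; trivial. now exists (Ph (2 * PI)).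
Qed.

Lemma period_defect_0_of_isochronous (g : R -> R) (p : nat -> R) (rho : R) :
  p 1%nat = 1 -> Rbar_lt rho (CV_radius p) ->
  energy_chart g (PSeries p) (PSeries (PS_derive p)) rho ->
  is_isochronous_center g -> forall n, period_defect p n = 0.
Proof.
intros p1 Hp Hch [_ (T & d & Hd & HT)].
assert (Hch' := Hch). destruct Hch' as (Hr & Hphi0 & _).
set (e := period_defect p). set (tau := T / (2 * PI) - 1).
assert (HPI := PI_RGT_0).
assert (He := CV_radius_period_defect p rho Hr Hp). fold e in He.
assert (Hr2 : 0 < rho ^ 2) by (apply pow_lt; lra).
(* Orbits through [(0, r)] are used: there [u = r * sin th] with [0 < th < PI], so that [w = u ^ 2]
   is positive, and at most [r ^ 2]. *)
assert (Hval : forall eps, 0 < eps -> exists w, 0 < w < eps /\ PSeries e w = tau).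
{ intros eps Heps. set (r := Rmin (Rmin rho d) (Rmin eps 1) / 2).
  assert (Hrr : 0 < r /\ r < rho /\ r < d /\ r < eps /\ r < 1).
  { assert (0 < Rmin (Rmin rho d) (Rmin eps 1)) by (repeat apply Rmin_pos; lra).
    assert (h1 := Rmin_l (Rmin rho d) (Rmin eps 1)). assert (h2 := Rmin_r (Rmin rho d) (Rmin eps 1)).
    assert (h3 := Rmin_l rho d). assert (h4 := Rmin_r rho d).
    assert (h5 := Rmin_l eps 1). assert (h6 := Rmin_r eps 1). unfold r. lra. }
  assert (Hr1 : 0 < 0 ^ 2 + r ^ 2 < rho ^ 2) by (simpl; nra).
  destruct (ex_time_of_angle g _ _ rho 0 r Hch (proj2 Hr1)) as [Ph HPh].
  destruct (energy_chart_periodic_solution g _ _ Ph rho 0 r Hch Hr1 HPh)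
    as (x & y & S & Ex & Ey & Hmin).
  assert (E : Ph (2 * PI) = T).
  { apply (HT x y); trivial. rewrite Ex, Ey, Hphi0. unfold in_punctured_disc.
    replace (0 ^ 2 + r ^ 2) with (r ^ 2) by ring. rewrite sqrt_pow2; lra. }
  destruct (time_of_angle_2PI g p rho 0 r Ph p1 Hp Hr (proj2 Hr1) HPh) as (th & Hth & E').
  exists (rot_x 0 r th ^ 2).
  assert (Hs : 0 < sin th) by (apply sin_gt_0; lra).
  assert (Hs1 := SIN_bound th).
  assert (Ev : rot_x 0 r th = r * sin th) by (unfold rot_x; ring).
  assert (Hv : 0 < r * sin th <= r) by (split; nra).
  split.
  - rewrite Ev. simpl. nra.
  - unfold tau. rewrite <- E, E'. unfold e. field. lra. }
assert (Hc : continuous (PSeries e) 0).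
{ apply continuous_PSeries with (rho ^ 2 / 2).
  - apply Rbar_lt_le_trans with (2 := He). simpl Rbar_lt. lra.
  - rewrite Rabs_R0. lra. }
assert (He0 : PSeries e 0 = 0) by (rewrite PSeries_0; reflexivity).
(* The value [tau] is taken arbitrarily close to 0, where the continuous function [PSeries e]
   vanishes. *)
assert (Htau : tau = 0).
{ destruct (Req_dec tau 0) as [h|h]; trivial. exfalso.
  destruct (continuous_Rabs_lt _ 0 (Rabs tau) Hc (Rabs_pos_lt _ h)) as (del & Hdel & Hdel').
  destruct (Hval del Hdel) as (w & Hw & Ew).
  specialize (Hdel' w). rewrite He0, Ew, !Rminus_0_r, (Rabs_pos_eq w) in Hdel' by lra.
  specialize (Hdel' ltac:(lra)). lra. }
destruct (PSeries_sign e) as [h|(eps & Heps & h)]; trivial.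
- apply Rbar_lt_le_trans with (2 := He). exact Hr2.
- exfalso. destruct (Hval eps Heps) as (w & Hw & Ew).
  destruct h as [h|h]; specialize (h w Hw); lra.
Qed.

(** The rotation provides a solution of minimal period [2 * PI] from each initial point near 0. An
    arbitrary solution with the same initial point is identified with it by uniqueness. *)
Lemma isochronous_of_period_defect_0 (g : R -> R) (p : nat -> R) (rho : R) :
  (forall x, continuous g x) -> analytic_at g 0 -> g 0 = 0 ->
  p 1%nat = 1 -> Rbar_lt rho (CV_radius p) ->
  energy_chart g (PSeries p) (PSeries (PS_derive p)) rho ->
  (forall u, Rabs u <= rho -> primitive0 g (PSeries p u) = u ^ 2 / 2) ->
  (forall n, period_defect p n = 0) -> is_isochronous_center g.
Proof.
intros Hc Hg g0 p1 Hp Hch HG He.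
assert (Hch' := Hch). destruct Hch' as (Hr & Hphi0 & H).
split; [exact (energy_chart_is_center g _ _ rho g0 Hch)|].
destruct (analytic_at_locally_Lipschitz g Hg) as (rL & L & HrL & HL0 & HL).
destruct (continuous_Rabs_lt (PSeries p) 0 rL) as (del & Hdel & Hdel'); trivial.
{ apply (ex_derive_continuous (PSeries p)). eexists. apply H. rewrite Rabs_R0. lra. }
rewrite Hphi0 in Hdel'.
set (eta := Rmin rho del / 2).
assert (Heta : 0 < eta < rho /\ eta < del).
{ assert (h1 := Rmin_l rho del). assert (h2 := Rmin_r rho del).
  assert (h3 := Rmin_pos _ _ Hr Hdel). unfold eta. lra. }
destruct Heta as [Heta Hetad].
exists (2 * PI), (eta / 4). split; [lra|].
intros x y S HS Hdisc Hmin.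
destruct (energy_chart_initial_point g _ _ rho eta _ _ Hch Heta Hdisc) as (u0 & Eu & Hu0 & Hu).
assert (Hu' : u0 ^ 2 + y 0 ^ 2 < rho ^ 2) by nra.
destruct (ex_time_of_angle g _ _ rho u0 (y 0) Hch Hu') as [Ph HPh].
destruct (energy_chart_periodic_solution g _ _ Ph rho u0 (y 0) Hch (conj Hu0 Hu') HPh)
  as (x2 & y2 & S2 & Ex & Ey & Hmin2).
destruct (time_of_angle_2PI g p rho u0 (y 0) Ph p1 Hp Hr Hu' HPh) as (th & _ & E).
rewrite (PSeries_ext _ (fun _ => 0) _ He), PSeries_const_0, Rplus_0_r, Rmult_1_r in E.
rewrite E in Hmin2.
assert (Huabs : Rabs u0 < eta).
{ rewrite <- (Rabs_pos_eq eta) by lra. apply Rsqr_lt_abs_0. unfold Rsqr.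
  assert (h := pow2_ge_0 (y 0)). simpl in Hu, h. lra. }
apply Rabs_def2 in Huabs.
assert (Hbd : forall v, Rabs v <= eta -> Rabs (PSeries p v) < rL).
{ intros v Hv. specialize (Hdel' v). rewrite !Rminus_0_r in Hdel'. apply Hdel'. lra. }
assert (Hb1 := Hbd eta ltac:(rewrite Rabs_pos_eq; lra)).
assert (Hb2 := Hbd (- eta) ltac:(rewrite Rabs_Ropp, Rabs_pos_eq; lra)).
apply Rabs_def2 in Hb1, Hb2.
(* The barriers are [phi (- eta)] and [phi eta], both of energy [eta ^ 2 / 2], while the initial
   energy [(u0 ^ 2 + y 0 ^ 2) / 2] is smaller. *)
assert (Hconf : forall X Y, is_solution g X Y -> X 0 = PSeries p u0 -> Y 0 = y 0 ->
  forall t, Rabs (X t) <= rL).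
{ intros X Y HXY E1 E2 t.
  assert (h := solution_confined g X Y (PSeries p (- eta)) (PSeries p eta) (eta ^ 2 / 2) Hc HXY).
  assert (Hint : PSeries p (- eta) < X t < PSeries p eta).
  { apply h.
    - rewrite HG; [apply Req_le; field|]. rewrite Rabs_Ropp, Rabs_pos_eq; lra.
    - rewrite HG; [apply Rle_refl|]. rewrite Rabs_pos_eq; lra.
    - rewrite E1.
      assert (h1 := energy_chart_incr g _ _ rho (- eta) u0 Hch).
      assert (h2 := energy_chart_incr g _ _ rho u0 eta Hch). lra.
    - rewrite E1, E2, HG; [lra|]. apply Rabs_le. lra. }
  apply Rabs_le. lra. }
assert (Hun : forall t, x t = x2 t /\ y t = y2 t).
{ apply (solution_unique g x y x2 y2 rL L); trivial.
  - now apply (Hconf x y).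
  - now apply (Hconf x2 y2).
  - now rewrite Ex.
  - now rewrite Ey. }
destruct Hmin as [[HS0 HSp] HSm]. destruct Hmin2 as [[HP0 HPp] HPm].
apply Rle_antisym.
- apply HSm. split; trivial. intros t.
  destruct (Hun (t + 2 * PI)) as [-> ->]. destruct (Hun t) as [-> ->]. apply HPp.
- apply HPm. split; trivial. intros t.
  destruct (Hun (t + S)) as [<- <-]. destruct (Hun t) as [<- <-]. apply HSp.
Qed.

(** * The involution as a function of the energy *)

(* Coefficients of [v * phi' v - phi v], which is [2 s A' - A] at [v = - sqrt (2 s)]. *)
Definition euler_defect (p : nat -> R) : nat -> R := PS_minus (PS_incr_1 (PS_derive p)) p.

Lemma euler_defect_odd (p : nat -> R) (n : nat) :
  euler_defect p (2 * n + 1) = 2 * INR n * p (2 * n + 1)%nat.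
Proof.
replace (2 * n + 1)%nat with (S (2 * n)) by lia.
unfold euler_defect, PS_minus, PS_plus, PS_opp, PS_incr_1, PS_derive, plus, opp; cbn -[INR Nat.mul].
rewrite S_INR, mult_INR. simpl (INR 2). ring.
Qed.

(** Both conditions say that [p (2 * n + 1) = 0] for [n >= 1]. At [n = 0] both are void: the factor
    [2 * n] vanishes on one side, and the constant term has been removed on the other. *)
Lemma period_defect_0_iff (p : nat -> R) :
  (forall n, period_defect p n = 0) <-> (forall n, euler_defect p (2 * n + 1) = 0).
Proof.
split; intros H n.
- rewrite euler_defect_odd. destruct n as [|n]; [simpl; ring|].
  specialize (H (S n)).
  change (INR (S (2 * S n)) * p (S (2 * S n)) = 0) in H.
  replace (2 * S n + 1)%nat with (S (2 * S n)) by lia.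
  apply Rmult_integral in H. destruct H as [H|H].
  + exfalso. revert H. apply not_0_INR. lia.
  + rewrite H. ring.
- destruct n as [|n]; [reflexivity|].
  change (INR (S (2 * S n)) * p (S (2 * S n)) = 0).
  specialize (H (S n)). rewrite euler_defect_odd in H.
  replace (2 * S n + 1)%nat with (S (2 * S n)) in H by lia.
  apply Rmult_integral in H. destruct H as [H|H].
  + exfalso. apply Rmult_integral in H. destruct H as [H|H]; [lra|].
    revert H. apply not_0_INR. lia.
  + rewrite H. ring.
Qed.

Lemma PSeries_euler_defect (p : nat -> R) (rho v : R) :
  Rbar_lt rho (CV_radius p) -> Rabs v <= rho ->
  PSeries (euler_defect p) v = v * PSeries (PS_derive p) v - PSeries p v.
Proof.
intros Hp Hv. assert (h := Rbar_lt_CV_radius p rho v Hp Hv).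
unfold euler_defect. rewrite PSeries_minus, PSeries_incr_1; trivial.
- apply ex_pseries_incr_1. apply CV_radius_inside. now rewrite CV_radius_derive.
- now apply CV_radius_inside.
Qed.

Lemma CV_radius_euler_defect (p : nat -> R) (rho : R) :
  0 < rho -> Rbar_lt rho (CV_radius p) -> Rbar_lt 0 (CV_radius (euler_defect p)).
Proof.
intros Hr Hp. apply Rbar_lt_le_trans with (Rabs rho); [simpl; rewrite Rabs_pos_eq; lra|].
assert (h : Rbar_lt (Rabs rho) (CV_radius p)) by (rewrite Rabs_pos_eq; trivial; lra).
apply CV_radius_ge_of_ex_pseries. apply ex_pseries_minus.
- apply ex_pseries_incr_1. apply CV_radius_inside. now rewrite CV_radius_derive.
- now apply CV_radius_inside.
Qed.

Lemma potential_injective_left (g : R -> R) (a b z1 z2 : R) :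
  (forall x, continuous g x) -> (forall x, a < x < b -> x <> 0 -> 0 < x * g x) -> 0 < b ->
  a < z1 < 0 -> a < z2 < 0 -> primitive0 g z1 = primitive0 g z2 -> z1 = z2.
Proof.
intros Hc Hg Hb.
assert (Hlt : forall z1 z2, a < z1 -> z1 < z2 -> z2 < 0 -> primitive0 g z1 <> primitive0 g z2).
{ intros w1 w2 h1 h2 h3 E.
  destruct (MVT_cor2 (primitive0 g) g w1 w2 h2) as (z & Ez & Hz).
  - intros z _. apply is_derive_Reals. now apply is_derive_primitive0.
  - specialize (Hg z ltac:(lra) ltac:(lra)). nra. }
intros h1 h2 E. destruct (Rtotal_order z1 z2) as [h|[h|h]]; trivial; exfalso.
- now apply (Hlt z1 z2).
- now apply (Hlt z2 z1).
Qed.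

(** For [u = sqrt (2 * s)], the point [phi u] lies in [(0, b)] at energy [s], so [AG s = A (phi u)].
    This point and [phi (- u)] are both negative with energy [s], and the potential is injective on
    [(a, 0)]. *)
Lemma involution_of_energy (g phi dphi A AG : R -> R) (rho a b : R) :
  (forall x, continuous g x) -> a < 0 -> 0 < b ->
  (forall x, a < x < b -> x <> 0 -> 0 < x * g x) ->
  is_potential_involution (primitive0 g) a b A ->
  is_function_of_energy (primitive0 g) b A AG ->
  energy_chart g phi dphi rho ->
  (forall u, Rabs u <= rho -> primitive0 g (phi u) = u ^ 2 / 2) ->
  exists e, 0 < e /\ forall s, 0 < s < e -> AG s = phi (- sqrt (2 * s)).
Proof.
intros Hc Ha Hb Hg [A0 HA] HAG Hch HG.
assert (Hch' := Hch). destruct Hch' as (Hr & Hphi0 & H).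
destruct (continuous_Rabs_lt phi 0 (Rmin (- a) b)) as (d & Hd & Hd').
{ apply (ex_derive_continuous phi). eexists. apply H. rewrite Rabs_R0. lra. }
{ apply Rmin_pos; lra. }
set (m := Rmin rho d).
assert (Hm : 0 < m /\ m <= rho /\ m <= d).
{ unfold m. repeat split; [now apply Rmin_pos | apply Rmin_l | apply Rmin_r]. }
exists (m ^ 2 / 2). split; [assert (0 < m ^ 2) by (apply pow_lt; lra); lra|].
intros s Hs.
assert (Hu := sqrt_double_small s m ltac:(lra) ltac:(lra) ltac:(lra)).
assert (Hu2 := sqrt_double_sqr s ltac:(lra)).
set (u := sqrt (2 * s)) in *.
assert (Hlt : forall v, Rabs v < m -> a < phi v < b).
{ intros v Hv. specialize (Hd' v). rewrite Hphi0, !Rminus_0_r in Hd'. specialize (Hd' ltac:(lra)).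
  assert (h1 := Rmin_l (- a) b). assert (h2 := Rmin_r (- a) b). apply Rabs_def2 in Hd'. lra. }
assert (Hau : Rabs u < m) by (rewrite Rabs_pos_eq; lra).
assert (Hau' : Rabs (- u) < m) by now rewrite Rabs_Ropp.
assert (h1 := energy_chart_incr g phi dphi rho 0 u Hch ltac:(lra) ltac:(lra) ltac:(lra)).
assert (h2 := energy_chart_incr g phi dphi rho (- u) 0 Hch ltac:(lra) ltac:(lra) ltac:(lra)).
rewrite Hphi0 in h1, h2.
assert (Eu : primitive0 g (phi u) = s) by (rewrite HG; lra).
assert (Eu' : primitive0 g (phi (- u)) = s).
{ rewrite HG; [|lra]. replace ((- u) ^ 2) with (u ^ 2) by ring. lra. }
assert (Hpu := Hlt u Hau). assert (Hpu' := Hlt (- u) Hau').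
rewrite <- Eu at 1. rewrite HAG by lra.
destruct (HA (phi u) Hpu) as (Hin & EA & Hneg). specialize (Hneg ltac:(lra)).
apply (potential_injective_left g a b); trivial.
- split; [lra|]. nra.
- lra.
- now rewrite EA, Eu, Eu'.
Qed.

Lemma is_derive_sqrt_branch (phi dphi : R -> R) (s : R) :
  0 < s -> is_derive phi (- sqrt (2 * s)) (dphi (- sqrt (2 * s))) ->
  is_derive (fun s => phi (- sqrt (2 * s))) s (dphi (- sqrt (2 * s)) * - / sqrt (2 * s)).
Proof.
intros Hs Hd. apply (is_derive_comp_R phi (fun s => - sqrt (2 * s))); trivial.
assert (h : 0 < sqrt (2 * s)) by (apply sqrt_lt_R0; lra).
auto_derive; [lra|]. field. lra.
Qed.

Theorem mainTheorem12
  (g : R -> R)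
  (g_analytic : forall x : R, analytic_at g x)
  (g_0 : g 0 = 0)
  (g'_0 : is_derive g 0 1)
  (a b c : R)
  (a_lt_0 : a < 0) (b_gt_0 : 0 < b) (c_gt_0 : 0 < c)
  (G_a : primitive0 g a = c)
  (G_b : primitive0 g b = c)
  (G_lt_c : forall x : R, a < x < b -> x <> 0 -> primitive0 g x < c)
  (xg_gt_0 : forall x : R, a < x < b -> x <> 0 -> 0 < x * g x)
  (A : R -> R)
  (A_def : is_potential_involution (primitive0 g) a b A)
  (AG : R -> R)
  (AG_def : is_function_of_energy (primitive0 g) b A AG) :
  (is_isochronous_center g <->
   exists f : R -> R,
     locally 0 (fun t : R => analytic_at f t) /\
     at_right 0 (fun s : R =>
       ex_derive AG s /\ 2 * s * Derive AG s = AG s + primitive0 f s)) /\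
  AG 0 = 0 /\
  filterlim (fun s : R => AG s ^ 2 / (2 * s)) (at_right 0) (locally 1).
Proof.
assert (Hc : forall x, continuous g x) by (intros x; now apply analytic_at_continuous).
destruct (ex_energy_chart g Hc (g_analytic 0) g_0 g'_0) as (p & rho & p0 & p1 & Hp & Hch & HG).
assert (Hch' := Hch). destruct Hch' as (Hr & Hphi0 & H).
destruct (involution_of_energy g _ _ A AG rho a b Hc a_lt_0 b_gt_0 xg_gt_0 A_def AG_def Hch HG)
  as (e & He & EAG).
set (e' := Rmin e (rho ^ 2 / 2)).
assert (Hr2 : 0 < rho ^ 2) by (apply pow_lt; lra).
assert (He' : 0 < e' /\ e' <= e /\ e' <= rho ^ 2 / 2).
{ unfold e'. split; [apply Rmin_pos; lra|split; [apply Rmin_l | apply Rmin_r]]. }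
assert (Hs_small : forall s, 0 < s < e' -> 0 < sqrt (2 * s) < rho).
{ intros s Hs. apply sqrt_double_small; lra. }
(* With [v = - sqrt (2 * s)] one has [2 * s = v ^ 2] and [dv/ds = / v], so [2 * s] times the
   derivative of [phi v] is [v * phi' v]. *)
assert (Hode : forall s, 0 < s < e' ->
  ex_derive AG s /\ 2 * s * Derive AG s - AG s = PSeries (euler_defect p) (- sqrt (2 * s))).
{ intros s Hs. assert (Hu := Hs_small s Hs).
  assert (Hu2 := sqrt_double_sqr s ltac:(lra)).
  assert (Hau : Rabs (- sqrt (2 * s)) < rho) by (rewrite Rabs_Ropp, Rabs_pos_eq; lra).
  assert (HD : is_derive AG s (PSeries (PS_derive p) (- sqrt (2 * s)) * - / sqrt (2 * s))).
  { apply (is_derive_ext_loc (fun s => PSeries p (- sqrt (2 * s)))).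
    - apply locally_Rabs with (Rmin s (e' - s)); [apply Rmin_pos; lra|].
      intros t Ht. symmetry. apply EAG.
      assert (h1 := Rmin_l s (e' - s)). assert (h2 := Rmin_r s (e' - s)).
      apply Rabs_def2 in Ht. lra.
    - apply (is_derive_sqrt_branch (PSeries p) (PSeries (PS_derive p))); [lra|]. now apply H. }
  split; [eexists; apply HD|].
  rewrite (is_derive_unique _ _ _ HD), EAG by lra.
  rewrite (PSeries_euler_defect p rho); trivial; [|lra].
  set (u := sqrt (2 * s)) in *. rewrite <- Hu2. field. lra. }
assert (Hiff : is_isochronous_center g <-> forall n, euler_defect p (2 * n + 1) = 0).
{ rewrite <- period_defect_0_iff. split; intros h.
  - now apply (period_defect_0_of_isochronous g p rho).
  - now apply (isochronous_of_period_defect_0 g p rho). }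
split; [|split].
- rewrite Hiff, <- even_series_iff_primitive.
  + split; intros (f & Hf & HP); exists f; split; trivial;
      apply at_right_0_iff in HP; destruct HP as (e2 & He2 & HP); apply at_right_0_iff;
      exists (Rmin e' e2);
      (split; [apply Rmin_pos; lra|]); intros s Hs;
      assert (h1 := Rmin_l e' e2); assert (h2 := Rmin_r e' e2);
      destruct (Hode s ltac:(lra)) as [h3 h4]; specialize (HP s ltac:(lra)).
    * split; trivial. lra.
    * lra.
  + now apply CV_radius_euler_defect with rho.
  + unfold euler_defect, PS_minus, PS_plus, PS_opp, PS_incr_1. rewrite p0.
    unfold plus, opp, zero; simpl. ring.
- assert (E0 : primitive0 g 0 = 0) by apply (RInt_point 0 g).
  rewrite <- E0 at 1. rewrite AG_def by lra. apply A_def.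
(* The quotient is the square of [phi v / v] at [v = - sqrt (2 * s)], and [phi v / v] is the shifted
   series, equal to [p 1 = 1] at 0. Continuity is two-sided because [sqrt] is 0 at negative
   arguments. *)
- assert (Hq : continuous (fun u => PSeries (PS_decr_1 p) (- sqrt (2 * u)) ^ 2) 0).
  { apply (continuous_comp (fun u => PSeries (PS_decr_1 p) (- sqrt (2 * u))) (fun z => z ^ 2)).
    - apply (continuous_comp (fun u => - sqrt (2 * u)) (PSeries (PS_decr_1 p))).
      + apply (continuous_opp (fun u => sqrt (2 * u))).
        apply (continuous_comp (fun u => 2 * u) sqrt); [|apply continuous_sqrt].
        apply (ex_derive_continuous (fun u => 2 * u)). auto_derive. trivial.
      + apply continuous_PSeries with rho; [now rewrite CV_radius_decr_1|].
        rewrite Rmult_0_r, sqrt_0, Ropp_0, Rabs_R0. lra.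
    - apply (ex_derive_continuous (fun z => z ^ 2)). auto_derive. trivial. }
  unfold continuous in Hq.
  rewrite Rmult_0_r, sqrt_0, Ropp_0, PSeries_0 in Hq. unfold PS_decr_1 at 2 in Hq.
  rewrite p1, pow1 in Hq.
  apply (filterlim_ext_loc (fun u => PSeries (PS_decr_1 p) (- sqrt (2 * u)) ^ 2)).
  + apply at_right_0_iff. exists e'. split; [lra|]. intros s Hs.
    rewrite EAG by lra. rewrite (PSeries_decr_1_aux p _ p0).
    rewrite Rpow_mult_distr. replace ((- sqrt (2 * s)) ^ 2) with (sqrt (2 * s) ^ 2) by ring.
    rewrite sqrt_double_sqr by lra. field. lra.
  + apply filterlim_filter_le_1 with (2 := Hq). intros P HP. now apply filter_le_within.
Qed.
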